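(* Let $V_5\subset\mathbb{C}^2$ be the set of $(b,c)\in\mathbb{C}^2$ such that $f(z)=1+\frac{b}{z}+\frac{c}{z^2}$ is a quadratic rational map for which the critical point $0$ is periodic of period $5$. Then the geometric genus of $V_5$ (that is, of the complex projective plane algebraic curve $\overline{V_5}\subset\mathbb{P}^2$ that is the projective closure of $V_5$) is $1$.
   Context: A rational map $f:\mathbb{P}^1\to\mathbb{P}^1$, $\mathbb{P}^1=\mathbb{C}\cup\{\infty\}$, is quadratic if it has degree $2$; for $f(z)=1+b/z+c/z^2$ this means $c\neq 0$, and then $0$ is a critical point with $f(0)=\infty$ and $f(\infty)=1$. So $(b,c)\in V_5$ means that $f$ has the critical cycle $0\mapsto\infty\mapsto 1\mapsto f(1)\mapsto f^2(1)\mapsto f^3(1)=0$ of period $5$. (In the paper, $V_n$ denotes the set of holomorphic conjugacy classes of quadratic rational maps with a critical point of period $n$, and for $n\ge 3$ it is taken to be the set of $(b,c)\in\mathbb{C}^2$ such that $f(z)=1+\frac{b}{z}+\frac{c}{z^2}$ is a quadratic rational map for which the critical point $0$ is periodic of period $n$.) The projective closure $\overline{V_5}$ is the Zariski closure of $V_5$ in $\mathbb{P}^2$ with homogeneous coordinates $[a:b:c]$, where $\mathbb{C}^2$ is embedded by $(b,c)\mapsto[1:b:c]$. The geometric genus of an irreducible projective curve is the genus of its smooth projective model (normalization). *)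

(* Defs.v *)
From HB Require Import structures.
From mathcomp Require Import all_boot all_order all_algebra.
From mathcomp Require Import classical_sets reals.
From mathcomp Require Import complex.
From mathcomp Require Import mpoly.

Set Implicit Arguments.
Unset Strict Implicit.
Unset Printing Implicit Defensive.

Import GRing.Theory.
Local Open Scope classical_set_scope.
Local Open Scope ring_scope.

(** * Subvarieties of projective space over an algebraically closed field

   A point of P^n is given by a nonzero row vector of homogeneous coordinates;
   two such vectors are the same point when they are proportional.  A subset
   of P^n is the set of all homogeneous coordinate vectors of its points. *)

Definition same_point (k : closedFieldType) (n : nat) (x y : 'rV[k]_n.+1) :=
  exists2 a : k, a != 0 & y = a *: x.

Definition pclosed (k : closedFieldType) (n : nat) (Z : set 'rV[k]_n.+1) :=
  exists S : set {mpoly k[n.+1]},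
    (forall F, S F -> exists d : nat, F \is d.-homog) /\
    (forall x, Z x <-> x != 0 /\ (forall F, S F -> F.@[x 0] = 0)).

Definition pclosure (k : closedFieldType) (n : nat) (A : set 'rV[k]_n.+1) :
    set 'rV[k]_n.+1 :=
  [set x | forall Z, pclosed Z -> A `<=` Z -> Z x].

Definition pirreducible (k : closedFieldType) (n : nat)
    (X : set 'rV[k]_n.+1) :=
  (exists x, X x) /\
  (forall Z1 Z2, pclosed Z1 -> pclosed Z2 ->
     X `<=` Z1 `|` Z2 -> X `<=` Z1 \/ X `<=` Z2).

(* A chain Z_0 < Z_1 < ... < Z_d of irreducible closed subsets of X. *)
Definition has_chain (k : closedFieldType) (n : nat)
    (X : set 'rV[k]_n.+1) (d : nat) :=
  exists Z : nat -> set 'rV[k]_n.+1,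
    (forall i, (i <= d)%N ->
       [/\ pclosed (Z i), pirreducible (Z i) & Z i `<=` X]) /\
    (forall i, (i < d)%N -> Z i `<=` Z i.+1 /\ ~ (Z i.+1 `<=` Z i)).

Definition pdim_eq (k : closedFieldType) (n : nat)
    (X : set 'rV[k]_n.+1) (d : nat) :=
  has_chain X d /\ ~ has_chain X d.+1.

Definition irreducible_projective_curve (k : closedFieldType) (n : nat)
    (X : set 'rV[k]_n.+1) :=
  [/\ pclosed X, pirreducible X & pdim_eq X 1].

(** * Tangent spaces and smoothness *)

(* The differential of F at x, applied to the vector v. *)
Definition mdiff (k : closedFieldType) (n : nat) (F : {mpoly k[n.+1]})
    (x v : 'rV[k]_n.+1) : k :=
  \sum_(i < n.+1) (F^`M(i)).@[x 0] * v 0 i.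

(* The tangent space at x of the affine cone over X.  The tangent space of X
   itself at the point x is the quotient of this space by the line k x. *)
Definition cone_tangent (k : closedFieldType) (n : nat)
    (X : set 'rV[k]_n.+1) (x v : 'rV[k]_n.+1) :=
  forall (d : nat) (F : {mpoly k[n.+1]}), F \is d.-homog ->
    (forall y, X y -> F.@[y 0] = 0) -> mdiff F x v = 0.

(* Since X has dimension 1, its tangent space at x must have dimension 1,
   that is, the tangent space of the cone must have dimension 2. *)
Definition smooth_projective_curve (k : closedFieldType) (n : nat)
    (X : set 'rV[k]_n.+1) :=
  irreducible_projective_curve X /\
  (forall x, X x -> exists T : 'M[k]_(2, n.+1),
     row_free T /\ (forall v, cone_tangent X x v <-> (v <= T)%MS)).

(** * Regular differential 1-forms and the genus *)

(* The fraction F / G is a rational function on P^n, regular at x. *)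
Definition regular_frac (k : closedFieldType) (n : nat)
    (F G : {mpoly k[n.+1]}) (x : 'rV[k]_n.+1) :=
  G.@[x 0] != 0 /\ exists d : nat, F \is d.-homog /\ G \is d.-homog.

Definition frac_val (k : closedFieldType) (n : nat)
    (F G : {mpoly k[n.+1]}) (x : 'rV[k]_n.+1) : k :=
  F.@[x 0] / G.@[x 0].

(* The differential d(F / G) at x, applied to v.  When F and G have the same
   degree it vanishes on v = x by Euler's identity, so it is well defined on
   the tangent space of X at x. *)
Definition frac_diff (k : closedFieldType) (n : nat)
    (F G : {mpoly k[n.+1]}) (x v : 'rV[k]_n.+1) : k :=
  (mdiff F x v * G.@[x 0] - F.@[x 0] * mdiff G x v) / G.@[x 0] ^+ 2.

(* A differential form on X assigns to x in X a function w x on the tangent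
   space at x.  It is regular when every point has a neighbourhood in X on
   which it equals \sum_i f_i d(g_i) with f_i, g_i regular functions (here
   f_i = A i / B i, g_i = G i / H i, and the neighbourhood is the locus where
   none of the B i, H i vanish).  The values of w outside the tangent spaces
   of X are irrelevant. *)
Definition regular_form (k : closedFieldType) (n : nat)
    (X : set 'rV[k]_n.+1) (w : 'rV[k]_n.+1 -> 'rV[k]_n.+1 -> k) :=
  forall x, X x ->
  exists (m : nat) (A B G H : 'I_m -> {mpoly k[n.+1]}),
    (forall i, regular_frac (A i) (B i) x /\ regular_frac (G i) (H i) x) /\
    (forall y v, X y ->
       (forall i, (B i).@[y 0] != 0 /\ (H i).@[y 0] != 0) ->
       cone_tangent X y v ->
       w y v =
         \sum_(i < m) frac_val (A i) (B i) y * frac_diff (G i) (H i) y v).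

(* The space of global regular 1-forms on X has a basis w_0, ..., w_(g-1). *)
Definition genus_eq (k : closedFieldType) (n : nat)
    (X : set 'rV[k]_n.+1) (g : nat) :=
  exists w : 'I_g -> 'rV[k]_n.+1 -> 'rV[k]_n.+1 -> k,
    [/\ forall i, regular_form X (w i),
        forall c : 'I_g -> k,
          (forall x v, X x -> cone_tangent X x v ->
             \sum_(i < g) c i * w i x v = 0) ->
          forall i, c i = 0
      & forall u, regular_form X u ->
          exists c : 'I_g -> k, forall x v, X x -> cone_tangent X x v ->
            u x v = \sum_(i < g) c i * w i x v].

(** * Morphisms, birational morphisms and the geometric genus *)

Definition popen_in (k : closedFieldType) (n : nat)
    (X U : set 'rV[k]_n.+1) :=
  exists2 Z, pclosed Z & forall x, U x <-> X x /\ ~ Z x.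

(* Near every point of U, f is given by homogeneous polynomials of the same
   degree without common zero. *)
Definition regular_map (k : closedFieldType) (n m : nat)
    (U : set 'rV[k]_n.+1) (f : 'rV[k]_n.+1 -> 'rV[k]_m.+1) :=
  forall x, U x ->
  exists (d : nat) (F : 'I_m.+1 -> {mpoly k[n.+1]}),
    [/\ forall j, F j \is d.-homog,
        \row_j (F j).@[x 0] != 0
      & forall y, U y -> \row_j (F j).@[y 0] != 0 ->
          same_point (f y) (\row_j (F j).@[y 0])].

(* f is a morphism X -> Y that restricts to an isomorphism, with inverse g,
   between nonempty open subsets U of X and V of Y. *)
Definition birational_morphism (k : closedFieldType) (n m : nat)
    (X : set 'rV[k]_n.+1) (Y : set 'rV[k]_m.+1)
    (f : 'rV[k]_n.+1 -> 'rV[k]_m.+1) :=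
  [/\ regular_map X f,
      forall x, X x -> Y (f x)
    & exists (U : set 'rV[k]_n.+1) (V : set 'rV[k]_m.+1)
             (g : 'rV[k]_m.+1 -> 'rV[k]_n.+1),
        [/\ popen_in X U /\ (exists x, U x),
            popen_in Y V /\ (exists y, V y),
            regular_map V g,
            forall x, U x -> V (f x) /\ same_point (g (f x)) x
          & forall y, V y -> U (g y) /\ same_point (f (g y)) y]].

(* A smooth projective curve X with a birational morphism X -> Y is the
   normalization of the projective curve Y; it is unique up to isomorphism. *)
Definition geometric_genus_eq (k : closedFieldType) (m : nat)
    (Y : set 'rV[k]_m.+1) (g : nat) :=
  irreducible_projective_curve Y /\
  exists (n : nat) (X : set 'rV[k]_n.+1) (f : 'rV[k]_n.+1 -> 'rV[k]_m.+1),
    [/\ smooth_projective_curve X, birational_morphism X Y f & genus_eq X g].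

(* The image of a subset of the affine plane under (b, c) |-> [1 : b : c]. *)
Definition plane_embedding (k : closedFieldType) (V : set (k * k)) :
    set 'rV[k]_3 :=
  [set x | exists2 bc, V bc &
     same_point (\row_(i < 3) [:: 1; bc.1; bc.2]`_i) x].

(** * Rational maps of the Riemann sphere, with None as the point at infinity *)

(* The map z |-> p(z) / q(z), for p and q coprime. *)
Definition ratmap (k : closedFieldType) (p q : {poly k}) (z : option k) :
    option k :=
  match z with
  | Some z => if q.[z] == 0 then None else Some (p.[z] / q.[z])
  | None => let d := (maxn (size p) (size q)).-1 in
            if q`_d == 0 then None else Some (p`_d / q`_d)
  end.

(* The fraction p / q is in lowest terms and of degree 2. *)
Definition quadratic (k : closedFieldType) (p q : {poly k}) :=
  coprimep p q /\ (maxn (size p) (size q)).-1 = 2%N.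

Definition critical_point (k : closedFieldType) (p q : {poly k}) (z : k) :=
  root (p^`() * q - p * q^`()) z.

Definition has_period (T : Type) (f : T -> T) (n : nat) (z : T) :=
  [/\ (0 < n)%N, iter n f z = z
    & forall m, (0 < m < n)%N -> iter m f z <> z].

(* Numerator and denominator of 1 + b / z + c / z ^ 2. *)
Definition fnum (k : closedFieldType) (b c : k) : {poly k} :=
  'X^2 + b *: 'X + c%:P.
Definition fden (k : closedFieldType) : {poly k} := 'X^2.

Definition V_set (k : closedFieldType) (n : nat) : set (k * k) :=
  [set bc | let p := fnum bc.1 bc.2 in let q := fden k in
     [/\ quadratic p q, critical_point p q 0
       & has_period (ratmap p q) n (Some 0)]].
Arguments V_set : clear implicits.

(* Main.v *)
Require Import Defs.
From mathcomp Require Import all_boot all_order all_algebra.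
From mathcomp Require Import reals complex.
From mathcomp Require Import classical_sets boolp mpoly ring.

(** Put u = f(1) = 1 + b + c, x = u - 1 and y = f(u) - 1.  Then b and c are
   rational functions of x and y, and the condition f(f(u)) = 0 becomes
     (x^2 + 3 x + 1) y^2 + x y + x^2 + x = 0,
   a double cover of the x-line.  With T = - 1 / x and
   s = (2 (x^2 + 3 x + 1) y + x) / x^2 it turns into
     s^2 = 4 T^3 - 15 T^2 + 16 T - 4,
   and t = T - 2 moves the root T = 2 to the origin:
     s^2 = g(t) = 4 t^3 + 9 t^2 + 4 t.
   The closure E of this affine cubic in the projective plane is smooth, because
   g has simple roots, and (t, s) |-> (b, c) extends to a morphism from E onto
   the closure of the period-5 curve which has an inverse given by cubic forms
   ([V5_paraminv], [param_V5], [paramf_birational]).  So the claim is that E has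
   genus 1.

   The Poincare residue omega is a regular form on E without zeros, so that any
   regular form is h * omega for a function h which is regular everywhere
   ([form_ratioE], [form_ratio_near]), and such a function is constant
   ([E_regular_constant]).  The last point is proved on the double cover
   (t, s) |-> t of the line, without general theory.  The trace h(t, s) + h(t, -s)
   is a rational function of t without poles, also at infinity, hence a constant
   ([trace_constant]).  Subtracting from h its value at the ramification point
   (0, 0) makes h odd; then the trace of h^2 is 2 h^2, which is therefore
   constant, and it vanishes at (0, 0) ([regular_constant]).  The point at
   infinity is not special in this argument, since (t, s) |-> (1/t, s/t^2) is an
   automorphism of the curve that exchanges it with (0, 0).

   Irreducibility and dimension of both curves follow from one criterion: a form
   which does not vanish identically on the curve has finitely many zeros there
   ([curve_criterion]).  On E this holds because the coordinate ring of the affine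
   part is k[t] + k[t] s, where the norm p^2 - g q^2 of p + q s is a nonzero
   polynomial in t, as g has odd degree. *)

Set Implicit Arguments.
Unset Strict Implicit.
Unset Printing Implicit Defensive.

Import GRing.Theory.

(** * Closed subsets of projective space and a criterion for curves *)

Section ProjectiveSpace.
Local Open Scope classical_set_scope.
Local Open Scope ring_scope.
Variable k : closedFieldType.

Lemma same_point_refl n (x : 'rV[k]_n.+1) : same_point x x.
Proof. by exists 1; rewrite ?oner_eq0 ?scale1r. Qed.

Lemma same_point_sym n (x y : 'rV[k]_n.+1) : same_point x y -> same_point y x.
Proof. by case=> a a0 ->; exists a^-1; rewrite ?invr_eq0// scalerK. Qed.

Lemma same_point_trans n (x y z : 'rV[k]_n.+1) :
  same_point x y -> same_point y z -> same_point x z.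
Proof.
by case=> a a0 -> [b b0 ->]; exists (b * a); rewrite ?mulf_neq0// scalerA.
Qed.

Lemma same_point_neq0 n (x y : 'rV[k]_n.+1) :
  same_point x y -> x != 0 -> y != 0.
Proof. by case=> a a0 -> x0; rewrite scaler_eq0 negb_or a0. Qed.

Lemma row_neq0P n (x : 'rV[k]_n) : x != 0 -> exists i, x 0 i != 0.
Proof. by case/rV0Pn=> i; exists i. Qed.

Lemma same_point_minors n (x y : 'rV[k]_n.+1) : x != 0 -> y != 0 ->
  (forall i j, x 0 i * y 0 j = x 0 j * y 0 i) -> same_point x y.
Proof.
move=> /row_neq0P[i xi] y0 H; have yE : y = (y 0 i / x 0 i) *: x.
  apply/rowP=> j; rewrite mxE mulrAC; apply: (mulIf xi).
  by rewrite divfK// [RHS]mulrC H mulrC.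
exists (y 0 i / x 0 i) => //; apply: contra_neq y0 => yi0.
by rewrite yE yi0 scale0r.
Qed.

Lemma dhomog_scale n d (F : {mpoly k[n.+1]}) (a : k) (x : 'rV[k]_n.+1) :
  F \is d.-homog -> F.@[(a *: x) 0] = a ^+ d * F.@[x 0].
Proof.
move=> Fd; rewrite !mevalE mulr_sumr big_seq [RHS]big_seq.
apply: eq_bigr => m /(dhomog_mf Fd) /= md; rewrite mulrCA; congr (_ * _).
under eq_bigr => i _ do rewrite mxE exprMn.
by rewrite big_split/= prodrXr -mdegE md.
Qed.

Lemma dhomog_eq0_scale n d (F : {mpoly k[n.+1]}) (x y : 'rV[k]_n.+1) :
  F \is d.-homog -> same_point x y -> F.@[x 0] = 0 -> F.@[y 0] = 0.
Proof. by move=> Fd [a _ ->] Fx; rewrite (dhomog_scale _ _ Fd) Fx mulr0. Qed.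

Lemma pclosed_neq0 n (Z : set 'rV[k]_n.+1) x : pclosed Z -> Z x -> x != 0.
Proof. by case=> S [_ ZP] /ZP[]. Qed.

Lemma pclosed_same_point n (Z : set 'rV[k]_n.+1) x y :
  pclosed Z -> same_point x y -> Z x -> Z y.
Proof.
case=> S [Sh ZP] xy /ZP[x0 Fx]; apply/ZP; split.
  exact: same_point_neq0 xy x0.
by move=> F SF; have [d Fd] := Sh F SF; apply: dhomog_eq0_scale Fd xy (Fx F SF).
Qed.

(** Closed sets are stable under finite unions because the products of their
   equations are again homogeneous. *)
Lemma pclosedU n (Y Z : set 'rV[k]_n.+1) :
  pclosed Y -> pclosed Z -> pclosed (Y `|` Z).
Proof.
case=> S [Sh YP] [T [Th ZP]].
exists [set H | exists F G, [/\ S F, T G & H = F * G]]; split.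
  move=> _ [F [G [SF TG ->]]].
  have [d Fd] := Sh F SF; have [e Ge] := Th G TG.
  by exists (d + e)%N; apply: dhomogM.
move=> x; split.
  move=> [/YP[x0 Hx]|/ZP[x0 Hx]]; split=> // _ [F [G [SF TG ->]]].
    by rewrite mevalM (Hx _ SF) mul0r.
  by rewrite mevalM (Hx _ TG) mulr0.
move=> [x0 Hx]; have [[F SF Fx]|noF] := pselect (exists2 F, S F & F.@[x 0] != 0).
  right; apply/ZP; split=> // G TG; apply/eqP.
  have /eqP : (F * G).@[x 0] = 0 by apply: Hx; exists F, G.
  by rewrite mevalM mulf_eq0 (negPf Fx).
left; apply/YP; split=> // F SF; apply/eqP; apply: contra_notT noF => Fx.
by exists F.
Qed.

Lemma pclosed_point n (p : 'rV[k]_n.+1) :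
  p != 0 -> pclosed [set x | same_point p x].
Proof.
move=> p0; exists [set F | exists i j, F = p 0 i *: 'X_j - p 0 j *: 'X_i]; split.
  move=> _ [i [j ->]]; exists 1%N.
  by rewrite rpredB// rpredZ// dhomogX /= mdeg1.
move=> x; split.
  move=> /[dup] /same_point_neq0/(_ p0) x0 [a _ xE]; split=> //.
  by move=> _ [i [j ->]]; rewrite mevalB !mevalZ !mevalXU xE !mxE; ring.
move=> [x0 Hx]; apply: same_point_minors => // i j.
apply/eqP; rewrite -subr_eq0; apply/eqP.
have := Hx _ (ex_intro _ i (ex_intro _ j erefl)).
by rewrite mevalB !mevalZ !mevalXU => <-; ring.
Qed.

Lemma sub_pclosure n (A : set 'rV[k]_n.+1) : A `<=` pclosure A.
Proof. by move=> x Ax Z _; apply. Qed.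

Lemma pclosure_homog n (A : set 'rV[k]_n.+1) (x : 'rV[k]_n.+1) :
  (forall y, A y -> y != 0) ->
  pclosure A x <-> x != 0 /\ (forall d (F : {mpoly k[n.+1]}), F \is d.-homog ->
     (forall y, A y -> F.@[y 0] = 0) -> F.@[x 0] = 0).
Proof.
move=> A0; split=> [Ax|[x0 Hx] Z [S [Sh ZP]] AZ].
  pose S := [set F : {mpoly k[n.+1]} |
    (exists d, F \is d.-homog) /\ forall y, A y -> F.@[y 0] = 0].
  suff [x0 Hx] : x != 0 /\ forall F, S F -> F.@[x 0] = 0.
    by split=> // d F Fd FA; apply: Hx; split=> //; exists d.
  move/(_ [set x : 'rV[k]_n.+1 | x != 0 /\ forall F, S F -> F.@[x 0] = 0]): Ax; apply.
    by exists S; split=> // F [].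
  by move=> y Ay; split; [exact: A0|move=> F [_]; apply].
apply/ZP; split=> // F SF; have [d Fd] := Sh F SF.
by apply: Hx Fd _ => y /AZ/ZP[_]; apply.
Qed.

Lemma pclosed_pclosure n (A : set 'rV[k]_n.+1) :
  (forall y, A y -> y != 0) -> pclosed (pclosure A).
Proof.
move=> A0.
exists [set F : {mpoly k[n.+1]} |
  (exists d, F \is d.-homog) /\ forall y, A y -> F.@[y 0] = 0].
split; first by move=> F [].
move=> x; rewrite pclosure_homog//.
split=> -[x0 Hx]; split=> //; first by move=> F [[d Fd]]; exact: Hx Fd.
by move=> d F Fd FA; apply: Hx; split=> //; exists d.
Qed.

Lemma pclosed_pclosureE n (X : set 'rV[k]_n.+1) : pclosed X -> pclosure X = X.
Proof.
move=> Xc; apply/seteqP; split; last exact: sub_pclosure.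
by move=> x /(_ X Xc); apply.
Qed.

Lemma not_sub_pclosed n (A Z : set 'rV[k]_n.+1) :
  (forall y, A y -> y != 0) -> pclosed Z -> ~ (A `<=` Z) ->
  exists d (F : {mpoly k[n.+1]}), [/\ F \is d.-homog,
    forall z, Z z -> F.@[z 0] = 0 & exists2 x, A x & F.@[x 0] != 0].
Proof.
move=> A0 [S [Sh ZP]] AZ; apply: contra_notP AZ => noF x Ax.
apply/ZP; split; first exact: A0.
move=> F SF; have [d Fd] := Sh F SF; apply/eqP; apply: contra_notT noF => Fx.
exists d, F; split=> //; last by exists x.
by move=> z /ZP[_]; apply.
Qed.

(** Points are counted up to proportionality; a zero vector in the list is
   proportional to no point and does no harm. *)
Definition finitely_many_points n (A : set 'rV[k]_n.+1) :=
  exists s : seq 'rV[k]_n.+1, forall x, A x -> exists2 y, y \in s & same_point y x.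

Lemma finitely_many_sub n (A B : set 'rV[k]_n.+1) :
  A `<=` B -> finitely_many_points B -> finitely_many_points A.
Proof. by move=> AB [s Hs]; exists s => x /AB/Hs. Qed.

Lemma finitely_manyU n (A B : set 'rV[k]_n.+1) :
  finitely_many_points A -> finitely_many_points B ->
  finitely_many_points (A `|` B).
Proof.
move=> [s Hs] [t Ht]; exists (s ++ t) => x [/Hs|/Ht] [y ys yx]; exists y => //;
by rewrite mem_cat ys ?orbT.
Qed.

Lemma pirreducible_point n (p : 'rV[k]_n.+1) :
  pirreducible [set x | same_point p x].
Proof.
split; first by exists p; apply: same_point_refl.
move=> Y Z Yc Zc pYZ.
have [Yp|Zp] := pYZ p (same_point_refl p); [left|right] => x px;
exact: pclosed_same_point px _.
Qed.

(** A finite union of points is closed, so irreducibility peels off its points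
   one at a time. *)
Lemma finite_pirreducible n (Z : set 'rV[k]_n.+1) :
  pirreducible Z -> (forall x, Z x -> x != 0) -> finitely_many_points Z ->
  exists p, forall x, Z x -> same_point p x.
Proof.
move=> [[z Zz] Zirr] Z0 [s Hs].
have close (s' : seq 'rV[k]_n.+1) :
    pclosed [set x | x != 0 /\ exists2 y, y \in s' & same_point y x].
  elim: s' => [|y s' IH].
    exists [set 1]; split; first by move=> _ ->; exists 0%N; apply: dhomog1.
    move=> x; split=> [[_ [y]]|[_ /(_ 1 erefl)/eqP]]; first by rewrite in_nil.
    by rewrite meval1 oner_eq0.
  have [y0|y0] := eqVneq y 0; last first.
    have := pclosedU (pclosed_point y0) IH; congr pclosed.
    apply/seteqP; split=> [x [/= yx|[x0 [p ps px]]]|x [x0 [p]]].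
    - split; first exact: same_point_neq0 yx y0.
      by exists y => //; rewrite mem_head.
    - by split=> //; exists p => //; rewrite in_cons ps orbT.
    by rewrite in_cons => /orP[/eqP->|ps] px; [left|right; split=> //; exists p].
  move: IH; congr pclosed.
  apply/seteqP; split=> [x [x0 [p ps px]]|x [x0 [p]]].
    by split=> //; exists p => //; rewrite in_cons ps orbT.
  rewrite in_cons => /orP[/eqP-> [a _]|ps px]; last by split=> //; exists p.
  by rewrite y0 scaler0 => x00; rewrite x00 eqxx in x0.
elim: s Hs => [/(_ z Zz)[y]|y s IH Hs]; first by rewrite in_nil.
have [y0|y0] := eqVneq y 0.
  apply: IH => x Zx; have [p + px] := Hs x Zx.
  rewrite in_cons => /orP[/eqP pE|ps]; last by exists p.
  move: px (Z0 x Zx); rewrite pE y0 => -[a _ ->].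
  by rewrite scaler0 eqxx.
have [|Zy|Zs] := Zirr _ _ (pclosed_point y0) (close s).
- move=> x Zx; have [p + px] := Hs x Zx.
  rewrite in_cons => /orP[/eqP pE|ps]; [left; rewrite -pE//|right].
  by split; [exact: Z0|exists p].
- by exists y.
by apply: IH => x /Zs[].
Qed.

(** A set behaves like a curve as soon as hypersurfaces cut it in finitely many
   points, unless they contain it: two proper closed subsets are then too small
   to cover it, and a proper irreducible closed subset is a point. *)
Lemma curve_criterion n (A : set 'rV[k]_n.+1) :
  (forall x, A x -> x != 0) ->
  ~ finitely_many_points A ->
  finitely_many_points (pclosure A `\` A) ->
  (forall d (F : {mpoly k[n.+1]}), F \is d.-homog ->
     (exists2 x, A x & F.@[x 0] != 0) ->
     finitely_many_points [set x | A x /\ F.@[x 0] = 0]) ->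
  irreducible_projective_curve (pclosure A).
Proof.
move=> A0 Ainf Adiff Afin.
have Yc := pclosed_pclosure A0.
have proper Z : pclosed Z -> ~ (pclosure A `<=` Z) ->
    finitely_many_points (A `&` Z).
  move=> Zc YZ; have AZ : ~ (A `<=` Z) by move=> AZ; apply: YZ => x /(_ Z Zc AZ).
  have [d [F [Fd FZ FA]]] := not_sub_pclosed A0 Zc AZ.
  apply: finitely_many_sub (Afin d F Fd FA).
  by move=> x [Ax /FZ].
have [a Aa] : exists a, A a.
  apply: contra_notP Ainf => noA; exists [::] => x Ax.
  by case: noA; exists x.
have Yirr : pirreducible (pclosure A).
  split; first by exists a; apply: sub_pclosure.
  move=> Z1 Z2 Z1c Z2c YZ.
  have [|nYZ1] := pselect (pclosure A `<=` Z1); first by left.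
  have [|nYZ2] := pselect (pclosure A `<=` Z2); first by right.
  case: Ainf; apply: finitely_many_sub (finitely_manyU (proper _ Z1c nYZ1) (proper _ Z2c nYZ2)).
  by move=> x Ax; have [] := YZ x (sub_pclosure Ax); [left|right].
split=> //; split.
  exists (fun i => if i is 0%N then [set x | same_point a x] else pclosure A).
  have aY : [set x | same_point a x] `<=` pclosure A.
    by move=> x ax; apply: pclosed_same_point ax _ => //; apply: sub_pclosure.
  split=> [[_|i _]|[_|]//]; first 2 last.
  - split=> // YA; apply: Ainf; exists [:: a] => x Ax.
    by exists a; [rewrite mem_head|apply: YA; apply: sub_pclosure].
  - split=> //; [exact: pclosed_point (A0 a Aa)|exact: pirreducible_point].
  - by split.
move=> [Z [Zirr Zlt]].
have [Z0c [[z Z0z] _] _] := Zirr 0%N isT.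
have [Z1c Z1irr Z1Y] := Zirr 1%N isT.
have [_ _ Z2Y] := Zirr 2%N isT.
have [Z01 nZ10] := Zlt 0%N isT; have [Z12 nZ21] := Zlt 1%N isT.
have nYZ1 : ~ (pclosure A `<=` Z 1%N) by move=> YZ1; apply: nZ21 => x /Z2Y/YZ1.
have Z1fin : finitely_many_points (Z 1%N).
  apply: finitely_many_sub (finitely_manyU Adiff (proper _ Z1c nYZ1)) => x Zx.
  by have [Ax|nAx] := pselect (A x); [right|left; split=> //; apply: Z1Y].
have [p pZ] := finite_pirreducible Z1irr (fun x => pclosed_neq0 Z1c) Z1fin.
apply: nZ10 => x Zx; apply: (pclosed_same_point Z0c _ Z0z).
exact: same_point_trans (same_point_sym (pZ _ (Z01 _ Z0z))) (pZ _ Zx).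
Qed.

End ProjectiveSpace.

(** * Functions on a double cover of the line *)

Definition hornerR := (hornerD, hornerN, hornerM, hornerZ, horner_exp, hornerX,
  hornerC, horner0).

Section ClosedField.
Local Open Scope ring_scope.
Variable k : closedFieldType.

Lemma ex_sqrt (x : k) : exists s, s ^+ 2 = x.
Proof.
have [s] := @solve_monicpoly k 2 (fun i => if i == 0%N then x else 0) isT.
by rewrite !big_ord_recl big_ord0/= mulr1 mul0r !addr0 => sE; exists s.
Qed.

Lemma ex_nonroot (p : {poly k}) : p != 0 -> exists x, p.[x] != 0.
Proof. by move/closed_nonrootP. Qed.

Lemma finite_roots (p : {poly k}) :
  p != 0 -> exists r : seq k, forall x, p.[x] = 0 -> x \in r.
Proof.
move=> p0; have [r pE] := closed_field_poly_normal p; exists r => x /eqP.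
rewrite pE hornerZ mulf_eq0 lead_coef_eq0 (negPf p0)/=.
by rewrite -[_ == 0]/(root _ x) root_prod_XsubC.
Qed.

Lemma poly_eq0_cofinite (p q : {poly k}) :
  q != 0 -> (forall x, q.[x] != 0 -> p.[x] = 0) -> p = 0.
Proof.
move=> q0 H; apply/eqP; apply: contraT => p0.
have [x] := ex_nonroot (mulf_neq0 p0 q0).
by rewrite hornerM mulf_eq0 negb_or => /andP[/eqP + /H]; contradiction.
Qed.

End ClosedField.

Section DoubleCover.
Local Open Scope ring_scope.
Variables (k : closedFieldType) (g : {poly k}).
Hypotheses (two_neq0 : 2 != 0 :> k) (g_odd : odd (size g).-1).

(** The pair (p, q) stands for the function p(t) + q(t) s on the curve
   s^2 = g(t); [cmul], [cconj] and [cnorm] are the product, the conjugation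
   s |-> - s and the norm of its coordinate ring over k[t]. *)
Definition cval (a : {poly k} * {poly k}) (t s : k) := a.1.[t] + a.2.[t] * s.

Definition cmul (a b : {poly k} * {poly k}) :=
  (a.1 * b.1 + g * a.2 * b.2, a.1 * b.2 + a.2 * b.1).

Definition cconj (a : {poly k} * {poly k}) := (a.1, - a.2).

Definition cnorm (a : {poly k} * {poly k}) := a.1 ^+ 2 - g * a.2 ^+ 2.

Lemma cval_mul a b t s : s ^+ 2 = g.[t] ->
  cval (cmul a b) t s = cval a t s * cval b t s.
Proof. by rewrite /cval/= !hornerR => gt; rewrite -gt; ring. Qed.

Lemma cval0 t s : cval 0 t s = 0.
Proof. by rewrite /cval/= !horner0 mul0r addr0. Qed.

Lemma cvalD a b t s : cval (a + b) t s = cval a t s + cval b t s.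
Proof. by rewrite /cval/= !hornerR; ring. Qed.

Lemma cvalB a b t s : cval (a - b) t s = cval a t s - cval b t s.
Proof. by rewrite /cval/= !hornerR; ring. Qed.

Lemma cvalZ (c : k) a t s :
  cval (c *: a.1, c *: a.2) t s = c * cval a t s.
Proof. by rewrite /cval/= !hornerR; ring. Qed.

Lemma cval_poly p t s : cval (p, 0) t s = p.[t].
Proof. by rewrite /cval/= horner0 mul0r addr0. Qed.

Lemma cval_conj a t s : cval (cconj a) t s = cval a t (- s).
Proof. by rewrite /cval/= !hornerR; ring. Qed.

Lemma cval_norm a t s : s ^+ 2 = g.[t] ->
  (cnorm a).[t] = cval a t s * cval a t (- s).
Proof. by rewrite /cval/= !hornerR => gt; rewrite -gt; ring. Qed.

Lemma g_neq0 : g != 0.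
Proof. by apply: contraTneq g_odd => ->; rewrite size_poly0. Qed.

Lemma deg_mul (p q : {poly k}) : p != 0 -> q != 0 ->
  (size (p * q)).-1 = ((size p).-1 + (size q).-1)%N.
Proof.
move=> p0 q0; rewrite size_mul//.
by move: p0 q0; rewrite -!size_poly_gt0; case: size => // m; case: size => // n;
rewrite addSn addnS.
Qed.

(** In p^2 = g q^2 the left side has even degree and the right side odd
   degree. *)
Lemma cnorm_eq0 a : cnorm a = 0 -> a = 0.
Proof.
case: a => p q; rewrite /cnorm/= => /eqP; rewrite subr_eq0 => /eqP pq.
have [q0|q0] := eqVneq q 0.
  by move/eqP: pq; rewrite q0 expr0n/= mulr0 expf_eq0/= => /eqP ->.
have := congr1 (fun u : {poly k} => odd (size u).-1) pq.
rewrite /= (deg_mul g_neq0) ?expf_neq0// !size_exp oddD g_odd.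
by rewrite !oddM !andbF.
Qed.

Lemma cval_neq0_norm b t s : cval b t s != 0 -> cnorm b != 0.
Proof.
by apply: contra_neq => /cnorm_eq0 ->; rewrite cval0.
Qed.

(** Above each t outside a finite set the function vanishes at both points (t, s)
   and (t, - s), so p(t) and q(t) s vanish separately. *)
Lemma cval_dense a (q : {poly k}) : q != 0 ->
  (forall t s, s ^+ 2 = g.[t] -> q.[t] != 0 -> cval a t s = 0) -> a = 0.
Proof.
move=> q0 H; have qg0 : q * g != 0 by rewrite mulf_neq0 ?g_neq0.
have H2 t s : s ^+ 2 = g.[t] -> q.[t] != 0 -> a.1.[t] = 0 /\ a.2.[t] * s = 0.
  move=> st qt; have := H t s st qt.
  have := H t (- s); rewrite sqrrN => /(_ st qt).
  rewrite /cval => e1 e2.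
  by split; apply: (mulfI two_neq0); rewrite mulr0;
    [transitivity (a.1.[t] + a.2.[t] * s + (a.1.[t] + a.2.[t] * - s)); first ring
    |transitivity (a.1.[t] + a.2.[t] * s - (a.1.[t] + a.2.[t] * - s)); first ring];
    rewrite e1 e2 ?addr0 ?subr0.
have a1 : a.1 = 0.
  apply: poly_eq0_cofinite q0 _ => t qt; have [s st] := ex_sqrt g.[t].
  by have [] := H2 t s st qt.
have a2 : a.2 = 0.
  apply: poly_eq0_cofinite qg0 _ => t; rewrite hornerM mulf_eq0 negb_or.
  move=> /andP[qt gt]; have [s st] := ex_sqrt g.[t].
  have [_ /eqP] := H2 t s st qt.
  rewrite mulf_eq0 => /orP[/eqP //|/eqP s0].
  by move: gt; rewrite -st s0 expr0n eqxx.
by rewrite [a]surjective_pairing a1 a2.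
Qed.

(** The points where q vanishes are excluded: q = 1 for a function on the whole
   affine curve, and q = 'X for its composition with (t, s) |-> (1/t, s/t^2). *)
Definition regular_at (q : {poly k}) (h : k -> k -> k) (t0 s0 : k) :=
  exists a b, cval b t0 s0 != 0 /\
    forall t s, s ^+ 2 = g.[t] -> q.[t] != 0 -> cval b t s != 0 ->
      h t s = cval a t s / cval b t s.

Lemma regular_atB q h c t0 s0 : regular_at q h t0 s0 ->
  regular_at q (fun t s => h t s - c) t0 s0.
Proof.
case=> a [b [b0 H]]; exists (a - (c *: b.1, c *: b.2)), b; split=> // t s st qt bt.
by rewrite H// cvalB cvalZ mulrBl mulfK.
Qed.

Lemma regular_at_sqr q h t0 s0 : s0 ^+ 2 = g.[t0] -> regular_at q h t0 s0 ->
  regular_at q (fun t s => h t s ^+ 2) t0 s0.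
Proof.
move=> st0 [a [b [b0 H]]]; exists (cmul a a), (cmul b b).
split=> [|t s st qt]; first by rewrite cval_mul// mulf_neq0.
rewrite !cval_mul// mulf_eq0 orbb => bt.
by rewrite H// expr2 mulf_div.
Qed.

(** At one point (t0, s0) the denominators of h at (t0, s0) and, after
   conjugation, of h at (t0, -s0) are both invertible; this bounds the poles of
   the trace even where the cover is unramified and the two points differ. *)
Lemma trace_value q h (A B r : {poly k}) t0 s0 : s0 ^+ 2 = g.[t0] ->
  q != 0 -> r != 0 -> regular_at q h t0 s0 -> regular_at q h t0 (- s0) ->
  (forall t s, s ^+ 2 = g.[t] -> r.[t] != 0 ->
    (h t s + h t (- s)) * B.[t] = A.[t]) ->
  exists w, A.[t0] = B.[t0] * w /\ (q.[t0] != 0 -> w = h t0 s0 + h t0 (- s0)).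
Proof.
move=> st0 q0 r0 [a [b [b0 Hab]]] [c [d [d0 Hcd]]] HAB.
pose D := cmul b (cconj d).
pose C := cmul a (cconj d) + cmul (cconj c) b.
have DE t s : s ^+ 2 = g.[t] -> cval D t s = cval b t s * cval d t (- s).
  by move=> st; rewrite cval_mul// cval_conj.
have D0 : cval D t0 s0 != 0 by rewrite DE// mulf_neq0.
have HDC t s : s ^+ 2 = g.[t] -> q.[t] != 0 -> cval D t s != 0 ->
    h t s + h t (- s) = cval C t s / cval D t s.
  move=> st qt Dts; have := Dts; rewrite DE// mulf_eq0 negb_or => /andP[bt dt].
  rewrite Hab// Hcd ?sqrrN// cvalD !cval_mul// !cval_conj addf_div//.
clearbody C D.
have E : cmul (A, 0) D - cmul (B, 0) C = 0.
  apply: (@cval_dense _ (q * r * cnorm D)).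
    by rewrite !mulf_neq0// (cval_neq0_norm D0).
  move=> t s st; rewrite !hornerM (cval_norm _ st) !mulf_eq0 !negb_or.
  move=> /andP[/andP[qt rt] /andP[Dt _]].
  rewrite cvalB !cval_mul// !cval_poly -(HAB t s)// HDC//; field; exact: Dt.
exists (cval C t0 s0 / cval D t0 s0); split; last by move=> qt; rewrite HDC.
have /eqP := cval0 t0 s0; rewrite -E cvalB !cval_mul// !cval_poly subr_eq0.
by move/eqP => e; rewrite mulrA -e mulfK.
Qed.

(** The trace is a rational function of t without poles. *)
Lemma trace_polynomial h :
  (forall t s, s ^+ 2 = g.[t] -> regular_at 1 h t s) ->
  exists P : {poly k}, forall t s, s ^+ 2 = g.[t] -> h t s + h t (- s) = P.[t].
Proof.
move=> hreg; have reg2 t s : s ^+ 2 = g.[t] ->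
    regular_at 1 h t s /\ regular_at 1 h t (- s).
  by move=> st; split; apply: hreg; rewrite ?sqrrN.
have [s0 st0] := ex_sqrt g.[0].
have [a [b [b0 Hab]]] := hreg _ _ st0.
have N0 := cval_neq0_norm b0.
(* A / N is the trace of a / b; in lowest terms it is A' / Q. *)
pose A := (cmul a (cconj b)).1 *+ 2; pose N := cnorm b.
pose G := gcdp A N; pose A' := A %/ G; pose Q := N %/ G.
have AE : A = A' * G by rewrite divpK ?dvdp_gcdl.
have NE : N = Q * G by rewrite divpK ?dvdp_gcdr.
have cop : coprimep A' Q by apply: coprimep_div_gcd; rewrite N0 orbT.
have TQ t s : s ^+ 2 = g.[t] -> N.[t] != 0 -> (h t s + h t (- s)) * Q.[t] = A'.[t].
  move=> st Nt; have := Nt; rewrite NE hornerM mulf_eq0 negb_or => /andP[_ Gt].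
  apply: (mulIf Gt); rewrite -mulrA -!hornerM -AE -NE.
  have := Nt; rewrite (cval_norm _ st) mulf_eq0 negb_or => /andP[bs bms].
  rewrite !Hab ?sqrrN ?hornerC ?oner_eq0// addf_div// mulfVK ?mulf_neq0//.
  by rewrite /A /cval/= !hornerR -st; ring.
have Qconst : size Q == 1%N.
  apply: contraT => /closed_rootP[t1 /rootP Qt1].
  have [s1 st1] := ex_sqrt g.[t1]; have [r1 r2] := reg2 _ _ st1.
  have [w []] := trace_value st1 (oner_neq0 _) N0 r1 r2 TQ.
  rewrite Qt1 mul0r => At1 _.
  by have := coprimep_root cop (introT rootP At1); rewrite Qt1 eqxx.
have [c c0 QE] := size_poly1P _ Qconst.
exists (c^-1 *: A') => t s st; have [r1 r2] := reg2 _ _ st.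
have [w []] := trace_value st (oner_neq0 _) N0 r1 r2 TQ.
rewrite QE !hornerC oner_eq0 hornerZ => -> <- //.
by rewrite mulKf.
Qed.

Lemma horner_rev (P : {poly k}) t : t != 0 ->
  (\poly_(i < size P) P`_((size P).-1 - i)).[t] = P.[t^-1] * t ^+ (size P).-1.
Proof.
move=> t0; rewrite horner_poly horner_coef mulr_suml.
case E : (size P) => [|n]; first by rewrite !big_ord0.
rewrite (reindex_inj rev_ord_inj)/=; apply: eq_bigr => i _.
rewrite subSS subKn ?leq_ord// -mulrA exprVn; congr (_ * _).
by rewrite expfB_cond ?(negPf t0) ?leq_ord// mulrC.
Qed.

Section Constant.
Hypothesis g0 : g.[0] = 0.

Let zero_on : 0 ^+ 2 = g.[0] :> k.
Proof. by rewrite g0 expr0n. Qed.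

Definition regular_everywhere (h : k -> k -> k) :=
  (forall t s, s ^+ 2 = g.[t] -> regular_at 1 h t s) /\
  regular_at 'X (fun t s => h t^-1 (s / t ^+ 2)) 0 0.

Hypothesis g_inv : forall t s, t != 0 -> s ^+ 2 = g.[t] ->
  (s / t ^+ 2) ^+ 2 = g.[t^-1].

(** P'(0) is the leading coefficient of P, so P(1/t) has a pole at 0 unless P is
   constant. *)
Lemma trace_constant h : regular_everywhere h ->
  exists c, forall t s, s ^+ 2 = g.[t] -> h t s + h t (- s) = c.
Proof.
move=> [hreg hinf]; have [P HP] := trace_polynomial hreg.
have [P0|P0] := eqVneq P 0.
  by exists 0 => t s st; rewrite HP// P0 horner0.
suff /size1_polyC PE : (size P <= 1)%N.
  by exists P`_0 => t s st; rewrite HP// {1}PE hornerC.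
rewrite leqNgt; apply/negP => P2.
have X0 : 'X != 0 :> {poly k} by rewrite polyX_eq0.
(* P'(t) = t^(deg P) P(1/t) *)
pose P' := \poly_(i < size P) P`_((size P).-1 - i).
have hinf' : regular_at 'X (fun t s => h t^-1 (s / t ^+ 2)) 0 (- 0).
  by rewrite oppr0.
have [|w [+ _]] := trace_value (A := P') (B := 'X^((size P).-1)) zero_on X0 X0 hinf hinf'.
  move=> t s st; rewrite hornerX => t0.
  by rewrite mulNr HP ?g_inv// hornerXn horner_rev.
rewrite hornerXn expr0n; case E : (size P) P2 => [|[|n]]//= _.
rewrite mul0r => /eqP; rewrite horner_coef0 coef_poly E/= subn0.
by rewrite -[n.+1]/(n.+2.-1) -E -/(lead_coef P) lead_coef_eq0 (negPf P0).
Qed.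

(** After subtraction of h(0, 0) the constant trace of h is zero, so h is odd and
   h^2 is half its own trace, hence constant, hence zero. *)
Lemma regular_constant h : regular_everywhere h ->
  exists c, forall t s, s ^+ 2 = g.[t] -> h t s = c.
Proof.
move=> [hreg hinf]; pose h1 t s := h t s - h 0 0.
have h1reg : regular_everywhere h1.
  split=> [t s st|]; first exact: (regular_atB (h 0 0) (hreg _ _ st)).
  exact: (regular_atB (h 0 0) hinf).
have h2reg : regular_everywhere (fun t s => h1 t s ^+ 2).
  split=> [t s st|]; first exact: regular_at_sqr (h1reg.1 _ _ st).
  exact: (regular_at_sqr zero_on h1reg.2).
have [c1 Hc1] := trace_constant h1reg; have [c2 Hc2] := trace_constant h2reg.
have h10 : h1 0 0 = 0 by rewrite /h1 subrr.
have c10 : c1 = 0 by rewrite -(Hc1 _ _ zero_on) oppr0 h10 addr0.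
have c20 : c2 = 0 by rewrite -(Hc2 _ _ zero_on) oppr0 h10 expr0n addr0.
exists (h 0 0) => t s st; apply/eqP; rewrite -subr_eq0 -/(h1 t s).
have /eqP := Hc1 _ _ st; rewrite c10 addrC addr_eq0 => /eqP h1N.
have /eqP := Hc2 _ _ st; rewrite c20 h1N sqrrN -mulr2n -mulr_natl.
by rewrite mulf_eq0 (negPf two_neq0)/= expf_eq0/=.
Qed.

End Constant.
End DoubleCover.

(** * Homogeneous polynomials and their differentials *)

Section HomogeneousPolynomials.
Local Open Scope ring_scope.
Variable k : closedFieldType.

Lemma dhomXU n (i : 'I_n) : ('X_i : {mpoly k[n]}) \is 1.-homog.
Proof. by rewrite dhomogX /= mdeg1. Qed.

Lemma dhomM n d1 d2 d (F G : {mpoly k[n]}) :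
  F \is d1.-homog -> G \is d2.-homog -> (d1 + d2 == d)%N -> F * G \is d.-homog.
Proof. by move=> Fd Gd /eqP <-; apply: dhomogM. Qed.

Lemma dhomE n d1 m d (F : {mpoly k[n]}) :
  F \is d1.-homog -> (d1 * m == d)%N -> F ^+ m \is d.-homog.
Proof. by move=> Fd /eqP <-; apply: dhomogMn. Qed.

Lemma dhomD n d (F G : {mpoly k[n]}) :
  F \is d.-homog -> G \is d.-homog -> F + G \is d.-homog.
Proof. exact: dhomogD. Qed.

Lemma dhomN n d (F : {mpoly k[n]}) : F \is d.-homog -> - F \is d.-homog.
Proof. by move=> Fd; rewrite dhomogN. Qed.

Lemma mevalXn n (v : 'I_n -> k) (F : {mpoly k[n]}) m : (F ^+ m).@[v] = F.@[v] ^+ m.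
Proof. exact: rmorphXn. Qed.

Lemma mpoly_closed_ind n (P : {mpoly k[n]} -> Prop) :
  (forall c, P c%:MP) -> (forall i, P 'X_i) ->
  (forall F G, P F -> P G -> P (F + G)) ->
  (forall F G, P F -> P G -> P (F * G)) -> forall F, P F.
Proof.
move=> PC PX PD PM; elim/mpolyind => [|c m F _ _ PF]; first by rewrite -mpolyC0.
apply: (PD) => //; rewrite -mul_mpolyC; apply: (PM) => //.
rewrite mpolyXE_id; apply: big_ind => // [|i _]; first by rewrite -mpolyC1.
by elim: (m i) => [|j Pj]; rewrite ?expr0 -?mpolyC1// exprS; apply: PM.
Qed.

Lemma mdiffD n (F G : {mpoly k[n.+1]}) x v :
  mdiff (F + G) x v = mdiff F x v + mdiff G x v.
Proof.
rewrite /mdiff -big_split; apply: eq_bigr => i _ /=.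
by rewrite mderivD mevalD mulrDl.
Qed.

Lemma mdiffM n (F G : {mpoly k[n.+1]}) x v :
  mdiff (F * G) x v = mdiff F x v * G.@[x 0] + F.@[x 0] * mdiff G x v.
Proof.
rewrite /mdiff mulr_suml mulr_sumr -big_split; apply: eq_bigr => i _ /=.
by rewrite mderivM mevalD !mevalM; ring.
Qed.

Lemma mdiffC n (c : k) (x v : 'rV[k]_n.+1) : mdiff c%:MP x v = 0.
Proof. by apply: big1 => i _; rewrite mderivC meval0 mul0r. Qed.

Lemma mdiffX n (i : 'I_n.+1) (x v : 'rV[k]_n.+1) : mdiff 'X_i x v = v 0 i.
Proof.
rewrite /mdiff (bigD1 i)//= mderivX mevalZ big1 ?addr0.
  have -> : (U_(i) - U_(i))%MM = 0%MM :> 'X_{1..n.+1}.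
    by apply/mnmP => j; rewrite mnmBE mnm0E subnn.
  by rewrite mnm1E eqxx mpolyX0 meval1 !mul1r.
move=> j ji; rewrite mderivX mnm1E eq_sym (negPf ji).
by rewrite scale0r meval0 mul0r.
Qed.

Lemma mdiff_lin n (F : {mpoly k[n.+1]}) x (a : k) v w :
  mdiff F x (a *: v + w) = a * mdiff F x v + mdiff F x w.
Proof.
rewrite /mdiff mulr_sumr -big_split; apply: eq_bigr => i _ /=.
by rewrite !mxE; ring.
Qed.

Lemma dhomog_mderiv n d (F : {mpoly k[n]}) i :
  F \is d.-homog -> F^`M(i) \is d.-1.-homog.
Proof.
move=> Fd; apply/dhomogP => m; rewrite mcoeff_msupp mcoeff_mderiv => Fm.
have : (m + U_(i))%MM \in msupp F.
  by rewrite mcoeff_msupp; apply: contra_neq Fm => ->; rewrite mul0rn.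
by move/(dhomog_mf Fd) => /=; rewrite mdegD mdeg1 addn1 => <-.
Qed.

(** The derivatives have degree d - 1, and the vector contributes the missing
   factor; for d = 0 the polynomial is constant. *)
Lemma mdiff_scale n d (F : {mpoly k[n.+1]}) (a : k) x v : F \is d.-homog ->
  mdiff F (a *: x) (a *: v) = a ^+ d * mdiff F x v.
Proof.
move=> Fd; rewrite /mdiff mulr_sumr; apply: eq_bigr => i _.
rewrite (dhomog_scale _ _ (dhomog_mderiv i Fd)) mxE.
case: d Fd => [|d] Fd; last by rewrite exprSr/=; ring.
suff -> : F^`M(i) = 0 by rewrite meval0 !mulr0 !mul0r mulr0.
apply/mpolyP => m; rewrite mcoeff_mderiv mcoeff0 (dhomog_nemf_coeff Fd) ?mul0rn//.
by rewrite /= mdegD mdeg1 addn1.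
Qed.

Lemma euler_identity n d (F : {mpoly k[n.+1]}) x :
  F \is d.-homog -> mdiff F x x = d%:R * F.@[x 0].
Proof.
move=> Fd; rewrite mevalE mulr_sumr /mdiff.
transitivity (\sum_(m <- msupp F) \sum_(i < n.+1)
    F@_m * ((m i)%:R * \prod_j x 0 j ^+ m j)).
  rewrite exchange_big/=; apply: eq_bigr => i _.
  have -> : F^`M(i) = \sum_(m <- msupp F) (F@_m *: 'X_[m])^`M(i).
    by rewrite [in LHS](mpolyE F) (big_morph _ (mderivD i) (mderiv0 _ i)).
  rewrite (big_morph _ (mevalD (x 0)) (meval0 (x 0))) mulr_suml; apply: eq_bigr => m _ /=.
  rewrite mderivZ mderivX !mevalZ -mulrA; congr (_ * _).
  have [->|mi] := eqVneq (m i) 0%N; first by rewrite !mul0r.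
  rewrite -mulrA; congr (_ * _).
  have mE : m = (m - U_(i) + U_(i))%MM by rewrite submK// lep1mP.
  by rewrite -mevalX [in RHS]mE mpolyXD mevalM mevalXU.
rewrite big_seq [RHS]big_seq; apply: eq_bigr => m /(dhomog_mf Fd)/= <-.
by rewrite -mulr_sumr -mulr_suml -natr_sum mdegE; ring.
Qed.

Definition pullback n m (F : {mpoly k[m.+1]}) (G : 'I_m.+1 -> {mpoly k[n.+1]}) :=
  F \mPo [tuple G i | i < m.+1].

Lemma meval_pullback n m (F : {mpoly k[m.+1]}) (G : 'I_m.+1 -> {mpoly k[n.+1]})
    (x : 'rV[k]_n.+1) :
  (pullback F G).@[x 0] = F.@[(\row_j (G j).@[x 0]) 0].
Proof.
rewrite /pullback comp_mpoly_meval; apply: meval_eq => i.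
by rewrite tnth_mktuple mxE.
Qed.

Lemma dhomog_pullback n m d e (F : {mpoly k[m.+1]})
    (G : 'I_m.+1 -> {mpoly k[n.+1]}) :
  F \is d.-homog -> (forall i, G i \is e.-homog) ->
  pullback F G \is (e * d).-homog.
Proof.
move=> Fd Ge; rewrite /pullback comp_mpolyEX big_seq rpred_sum// => mm mF.
rewrite rpredZ// comp_mpolyX -(dhomog_mf Fd mF)/= mdegE big_distrr/=.
apply: (big_ind2 (fun p d => p \is d.-homog)).
- exact: dhomog1.
- by move=> p d1 q d2; apply: dhomogM.
by move=> i _; rewrite tnth_mktuple; apply: dhomogMn.
Qed.

End HomogeneousPolynomials.

(* The degrees of the factors of a product are left open until the leaves,
   which are variables of degree 1, determine them. *)
Ltac dhom := first
  [ exact: dhomXU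
  | apply: dhomD; [dhom|dhom]
  | apply: dhomN; dhom
  | apply: dhomogZ; dhom
  | (eapply dhomM; [dhom|dhom|exact: eqxx])
  | (eapply dhomE; [dhom|exact: eqxx]) ].

Definition mevalR := (mevalD, mevalB, mevalN, mevalZ, mevalM, mevalXU, mevalXn,
  mevalC, meval1).

(** * The plane cubic *)

Section Vec3.
Local Open Scope ring_scope.

Definition i0 : 'I_3 := Ordinal (isT : (0 < 3)%N).
Definition i1 : 'I_3 := Ordinal (isT : (1 < 3)%N).
Definition i2 : 'I_3 := Ordinal (isT : (2 < 3)%N).

Lemma ord3_ind (P : 'I_3 -> Prop) : P i0 -> P i1 -> P i2 -> forall i, P i.
Proof.
move=> P0 P1 P2 [[|[|[|m]]] lt3] //.
- by rewrite (_ : Ordinal lt3 = i0)//; apply: val_inj.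
- by rewrite (_ : Ordinal lt3 = i1)//; apply: val_inj.
- by rewrite (_ : Ordinal lt3 = i2)//; apply: val_inj.
Qed.

Definition vec3 (k : fieldType) (a b c : k) : 'rV[k]_3 :=
  \row_(i < 3) [:: a; b; c]`_i.

Variable k : fieldType.
Implicit Types (a b c d : k).

Lemma vec3E0 a b c : vec3 a b c 0 i0 = a. Proof. by rewrite mxE. Qed.
Lemma vec3E1 a b c : vec3 a b c 0 i1 = b. Proof. by rewrite mxE. Qed.
Lemma vec3E2 a b c : vec3 a b c 0 i2 = c. Proof. by rewrite mxE. Qed.
Definition vec3E := (vec3E0, vec3E1, vec3E2).

Lemma row3P (x y : 'rV[k]_3) : x 0 i0 = y 0 i0 -> x 0 i1 = y 0 i1 ->
  x 0 i2 = y 0 i2 -> x = y.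
Proof. by move=> e0 e1 e2; apply/rowP; apply: ord3_ind. Qed.

Lemma vec3_eta (x : 'rV[k]_3) : vec3 (x 0 i0) (x 0 i1) (x 0 i2) = x.
Proof. by apply: row3P; rewrite vec3E. Qed.

Lemma scale_vec3 d a b c : d *: vec3 a b c = vec3 (d * a) (d * b) (d * c).
Proof. by apply: row3P; rewrite mxE !vec3E. Qed.

Lemma vec3_eq0 a b c : (vec3 a b c == 0) = [&& a == 0, b == 0 & c == 0].
Proof.
apply/eqP/and3P => [e|[/eqP-> /eqP-> /eqP->]].
  have coord i : vec3 a b c 0 i = 0 by rewrite e mxE.
  by have := (coord i0, coord i1, coord i2); rewrite !vec3E => -[[-> ->] ->].
by apply: row3P; rewrite vec3E mxE.
Qed.

Definition tuple3 (T : Type) (F0 F1 F2 : T) (i : 'I_3) : T :=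
  match val i with 0%N => F0 | 1%N => F1 | _ => F2 end.

End Vec3.

Section TheCurve.
Local Open Scope classical_set_scope.
Local Open Scope ring_scope.
Variable k : closedFieldType.
Hypothesis char0 : forall n, (n%:R == 0 :> k) = (n == 0)%N.

Lemma row_tuple3 (F0 F1 F2 : {mpoly k[3]}) (x : 'rV[k]_3) :
  \row_j (tuple3 F0 F1 F2 j).@[x 0] = vec3 F0.@[x 0] F1.@[x 0] F2.@[x 0].
Proof. by apply: row3P; rewrite mxE vec3E. Qed.

(** The cubic 4 t^3 + 9 t^2 + 4 t; it is palindromic up to a factor t, so that
   (t, s) |-> (1/t, s/t^2) preserves s^2 = g(t). *)
Definition g : {poly k} := Poly [:: 0; 4; 9; 4].

Lemma g_val t : g.[t] = 4 * t ^+ 3 + 9 * t ^+ 2 + 4 * t.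
Proof. by rewrite horner_Poly /=; ring. Qed.

Lemma deg_g : odd (size g).-1.
Proof. by rewrite (@PolyK _ 0) //= char0. Qed.

Lemma dg_val t : g^`().[t] = 12 * t ^+ 2 + 18 * t + 4.
Proof.
have -> : g = 4 *: 'X^3 + 9 *: 'X^2 + 4 *: 'X.
  apply/polyP => i; rewrite coef_Poly !coefD !coefZ !coefXn coefX.
  by case: i => [|[|[|[|i]]]] /=; rewrite ?nth_nil; ring.
by rewrite !derivE !hornerR; ring.
Qed.

Lemma two_neq0 : 2 != 0 :> k. Proof. by rewrite char0. Qed.

Definition W : {mpoly k[3]} :=
  'X_i1 ^+ 2 * 'X_i2 - (4 *: 'X_i0 ^+ 3 + 9 *: ('X_i0 ^+ 2 * 'X_i2) +
  4 *: ('X_i0 * 'X_i2 ^+ 2)).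

Lemma W_homog : W \is 3.-homog.
Proof. rewrite /W; dhom. Qed.

Lemma W_val (x : 'rV[k]_3) : W.@[x 0] = x 0 i1 ^+ 2 * x 0 i2 -
  (4 * x 0 i0 ^+ 3 + 9 * (x 0 i0 ^+ 2 * x 0 i2) + 4 * (x 0 i0 * x 0 i2 ^+ 2)).
Proof. by rewrite !mevalR. Qed.

Definition E : set 'rV[k]_3 := [set x : 'rV[k]_3 | x != 0 /\ W.@[x 0] = 0].

Lemma E_closed : pclosed E.
Proof.
exists [set W]; split; first by move=> _ ->; exists 3%N; exact: W_homog.
by move=> x; split=> -[x0 Wx]; split=> //; [move=> _ ->|exact: Wx].
Qed.

Definition aff (t s : k) : 'rV[k]_3 := vec3 t s 1.

Lemma aff_in t s : s ^+ 2 = g.[t] <-> E (aff t s).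
Proof.
rewrite /E /= W_val !vec3E g_val vec3_eq0 oner_eq0 !andbF.
split=> [st|[_ /eqP]]; first by split=> //; rewrite st; ring.
by rewrite subr_eq0 => /eqP; rewrite !mulr1 expr1n !mulr1 => ->; ring.
Qed.

Lemma E_finite_part x : E x -> x 0 i2 != 0 -> exists t s,
  s ^+ 2 = g.[t] /\ x = x 0 i2 *: aff t s.
Proof.
move=> Ex x2; exists (x 0 i0 / x 0 i2), (x 0 i1 / x 0 i2).
have xE : x = x 0 i2 *: aff (x 0 i0 / x 0 i2) (x 0 i1 / x 0 i2).
  by rewrite scale_vec3 -[LHS]vec3_eta mulr1 ![x 0 i2 * _]mulrC !divfK.
split=> //; apply/aff_in; apply: pclosed_same_point E_closed _ Ex.
by apply: same_point_sym; exists (x 0 i2).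
Qed.

Lemma E_infinite_part x : E x -> x 0 i2 = 0 -> x 0 i0 = 0 /\ x 0 i1 != 0.
Proof.
move=> [x0 +] x2; rewrite W_val x2 => Wx.
have /eqP : 4 * x 0 i0 ^+ 3 = 0 by rewrite -[RHS]oppr0 -Wx; ring.
rewrite mulf_eq0 char0/= expf_eq0/= => /eqP x00; split=> //.
by apply: contra_neq x0 => x1; apply: row3P; rewrite mxE.
Qed.

(** The substitution t |-> 1/t, s |-> s/t^2 preserves the equation of the curve;
   this is a projective form of it that is defined at the point (0, 0), whose
   image is the point at infinity. *)
Definition swap (i : 'I_3) : {mpoly k[3]} := tuple3 ('X_i1 * 'X_i2)
  (4 *: 'X_i0 ^+ 2 + 9 *: ('X_i0 * 'X_i2) + 4 *: 'X_i2 ^+ 2) ('X_i0 * 'X_i1) i.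

Lemma swap_aff t s : \row_j (swap j).@[aff t s 0] =
  vec3 s (4 * t ^+ 2 + 9 * t + 4) (t * s).
Proof.
by rewrite row_tuple3 !mevalR !vec3E; congr vec3; ring.
Qed.

Lemma swap_swap t s : t != 0 -> s != 0 -> s ^+ 2 = g.[t] ->
  vec3 s (4 * t ^+ 2 + 9 * t + 4) (t * s) = (t * s) *: aff t^-1 (s / t ^+ 2).
Proof.
move=> t0 s0 st; rewrite scale_vec3; congr vec3; last by rewrite mulr1.
  by field.
have -> : t * s * (s / t ^+ 2) = s ^+ 2 / t by field.
by rewrite st g_val; field.
Qed.

Lemma swap_on t s : t != 0 -> s ^+ 2 = g.[t] -> (s / t ^+ 2) ^+ 2 = g.[t^-1].
Proof. by move=> t0 st; rewrite expr_div_n st !g_val; field. Qed.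

(** The values on the affine curve of a polynomial and of its derivative along
   the tangent field (2 s, g'(t)) both follow from its reduction
   a(t) + b(t) s modulo s^2 - g(t). *)
Lemma reduction (F : {mpoly k[3]}) : exists a : {poly k} * {poly k},
  forall t s, s ^+ 2 = g.[t] -> F.@[aff t s 0] = cval a t s /\
    mdiff F (aff t s) (vec3 (2 * s) g^`().[t] 0) =
      2 * s * a.1^`().[t] + a.2.[t] * g^`().[t] + 2 * a.2^`().[t] * g.[t].
Proof.
elim/mpoly_closed_ind: F => [c|i|F G [a Ha] [b Hb]|F G [a Ha] [b Hb]].
- exists (c%:P, 0) => t s st; rewrite mevalC mdiffC /cval/= !derivE !hornerR.
  by split; ring.
- exists (tuple3 ('X, 0) (0, 1) (1, 0) i) => t s st.
  rewrite mevalXU mdiffX; elim/ord3_ind: i; rewrite !vec3E /cval/= !derivE !hornerR;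
    by split; ring.
- exists (a + b) => t s st; have [a1 a2] := Ha t s st; have [b1 b2] := Hb t s st.
  rewrite mevalD mdiffD a1 a2 b1 b2 cvalD /= !derivD !hornerD.
  by split; ring.
exists (cmul g a b) => t s st; have [a1 a2] := Ha t s st; have [b1 b2] := Hb t s st.
rewrite mevalM mdiffM a1 a2 b1 b2 cval_mul// /cval/= !derivE !hornerR -st.
by split; ring.
Qed.

Lemma meval_aff (F : {mpoly k[3]}) : exists a : {poly k} * {poly k},
  forall t s, s ^+ 2 = g.[t] -> F.@[aff t s 0] = cval a t s.
Proof. by have [a Ha] := reduction F; exists a => t s /Ha[]. Qed.

Lemma aff_dense (F : {mpoly k[3]}) (q : {poly k}) : q != 0 ->
  (forall t s, s ^+ 2 = g.[t] -> q.[t] != 0 -> F.@[aff t s 0] = 0) ->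
  forall t s, s ^+ 2 = g.[t] -> F.@[aff t s 0] = 0.
Proof.
move=> q0 HF t s st; have [a Ha] := meval_aff F; rewrite Ha//.
rewrite (cval_dense two_neq0 deg_g q0 (a := a)) ?cval0// => t' s' st' qt'.
by rewrite -Ha// HF.
Qed.

(** At the point at infinity apply the affine case to the pullback of F along
   [swap], whose value at (0, 0) is a nonzero multiple of F at infinity. *)
Lemma E_dense d (F : {mpoly k[3]}) (q : {poly k}) : F \is d.-homog -> q != 0 ->
  (forall t s, s ^+ 2 = g.[t] -> q.[t] != 0 -> F.@[aff t s 0] = 0) ->
  forall x, E x -> F.@[x 0] = 0.
Proof.
move=> Fd q0 HF x Ex; have {}HF := aff_dense q0 HF.
have [x2|x2] := eqVneq (x 0 i2) 0; last first.
  have [t [s [st ->]]] := E_finite_part Ex x2.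
  by rewrite (dhomog_scale _ _ Fd) HF ?mulr0.
have [x0 x1] := E_infinite_part Ex x2.
have : (pullback F swap).@[aff 0 0 0] = 0.
  apply: (aff_dense (q := 'X)); first by rewrite polyX_eq0.
    move=> t s st; rewrite hornerX meval_pullback swap_aff => t0.
    (* [swap] is the zero vector at the points with s = 0 and t != 0. *)
    have [s0|s0] := eqVneq s 0; last first.
      by rewrite swap_swap// (dhomog_scale _ _ Fd) HF ?mulr0// swap_on.
    rewrite s0; move: st; rewrite s0 expr0n/= g_val => /esym/eqP.
    have -> : 4 * t ^+ 3 + 9 * t ^+ 2 + 4 * t = t * (4 * t ^+ 2 + 9 * t + 4).
      by ring.
    rewrite mulf_eq0 (negPf t0)/= => /eqP ->; rewrite mulr0.
    have -> : vec3 0 0 0 = 0 *: aff 0 0 by rewrite scale0r; apply: row3P; rewrite !vec3E mxE.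
    by rewrite (dhomog_scale _ _ Fd) HF ?mulr0// g_val; ring.
  by rewrite g_val; ring.
rewrite meval_pullback swap_aff.
have <- : (4 / x 0 i1) *: x = vec3 0 (4 * 0 ^+ 2 + 9 * 0 + 4) (0 * 0).
  have xE : x = vec3 0 (x 0 i1) 0 by rewrite -[LHS]vec3_eta x0 x2.
  rewrite {2}xE scale_vec3; congr vec3; [ring| |ring].
  by rewrite divfK//; ring.
rewrite (dhomog_scale _ _ Fd) => /eqP; rewrite mulf_eq0 expf_eq0 mulf_eq0 invr_eq0.
by rewrite (negPf x1) char0/= andbF => /eqP.
Qed.

(** The zeros of F lie above the roots of the norm of its affine reduction, with
   at most two of them above each root. *)
Lemma E_zeros_finite d (F : {mpoly k[3]}) : F \is d.-homog ->
  (exists2 x, E x & F.@[x 0] != 0) ->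
  finitely_many_points [set x | E x /\ F.@[x 0] = 0].
Proof.
move=> Fd [x Ex Fx]; have [a Ha] := meval_aff F.
have N0 : cnorm g a != 0.
  apply: contra_neq Fx => /(cnorm_eq0 deg_g) a0.
  by apply: (E_dense Fd (oner_neq0 _)) Ex => t s st _; rewrite Ha// a0 cval0.
have [r Hr] := finite_roots N0.
have [f Hf] := choice (fun t => ex_sqrt (g.[t])).
exists (vec3 0 1 0 :: [seq aff t (f t) | t <- r] ++ [seq aff t (- f t) | t <- r]).
move=> y [Ey Fy]; have [y2|y2] := eqVneq (y 0 i2) 0.
  have [y0 y1] := E_infinite_part Ey y2; exists (vec3 0 1 0); first exact: mem_head.
  by exists (y 0 i1); rewrite // scale_vec3 -[LHS]vec3_eta y0 y2; congr vec3; ring.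
have [t [s [st yE]]] := E_finite_part Ey y2.
have tr : t \in r.
  apply: Hr; rewrite (cval_norm _ st) -Ha//.
  move/eqP: Fy; rewrite yE (dhomog_scale _ _ Fd) mulf_eq0 expf_eq0 (negPf y2) andbF/=.
  by move/eqP ->; rewrite mul0r.
have : (s == f t) || (s == - f t) by rewrite -eqf_sqr st Hf.
case/orP => /eqP sE; exists (aff t s); try by exists (y 0 i2).
  by rewrite in_cons mem_cat sE (map_f (fun t => aff t (f t)) tr) orbT.
by rewrite in_cons mem_cat sE (map_f (fun t => aff t (- f t)) tr) !orbT.
Qed.

Lemma E_infinite : ~ finitely_many_points E.
Proof.
move=> [l Hl]; pose q : {poly k} := \prod_(y <- l) ('X - (y 0 i0 / y 0 i2)%:P).
have q0 : q != 0 by rewrite monic_neq0 ?monic_prod_XsubC.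
have [t qt] := ex_nonroot q0; have [s st] := ex_sqrt g.[t].
have [y yl [a a0 e]] := Hl _ ((aff_in t s).1 st).
have : t == y 0 i0 / y 0 i2.
  have := congr1 (fun v : 'rV[k]_3 => v 0 i0) e.
  have := congr1 (fun v : 'rV[k]_3 => v 0 i2) e; rewrite !vec3E !mxE => e2 ->.
  have y2 : y 0 i2 != 0.
    by have := oner_neq0 k; rewrite e2 mulf_eq0 (negPf a0).
  by rewrite (_ : a = (y 0 i2)^-1) 1?mulrC//; apply: (mulIf y2); rewrite -e2 mulVf.
apply/negP; move: qt; rewrite horner_prod; apply: contra => /eqP ->.
by rewrite (big_rem _ yl)/= hornerXsubC subrr mul0r.
Qed.

Lemma E_cofinite d e (F B : {mpoly k[3]}) : F \is d.-homog -> B \is e.-homog ->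
  (exists2 x, E x & B.@[x 0] != 0) ->
  (forall x, E x -> B.@[x 0] != 0 -> F.@[x 0] = 0) ->
  forall x, E x -> F.@[x 0] = 0.
Proof.
move=> Fd Be Bx HF x Ex; apply/eqP; apply: contraT => Fx.
case: E_infinite; apply: finitely_many_sub (finitely_manyU
  (E_zeros_finite Fd (ex_intro2 _ _ x Ex Fx)) (E_zeros_finite Be Bx)) => y Ey.
have [By|By] := eqVneq B.@[y 0] 0; first by right.
by left; split=> //; apply: HF.
Qed.

Lemma E_curve : irreducible_projective_curve E.
Proof.
rewrite -(pclosed_pclosureE E_closed); apply: curve_criterion.
- by move=> x [].
- exact: E_infinite.
- by exists [::] => x [+ nEx]; rewrite (pclosed_pclosureE E_closed).
exact: E_zeros_finite.
Qed.

End TheCurve.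

Arguments E {k}.

(** * Fractions, tangent fields and regular forms *)

Section Fractions.
Local Open Scope ring_scope.
Variable k : closedFieldType.

Lemma mdiffN n (F : {mpoly k[n.+1]}) x v : mdiff (- F) x v = - mdiff F x v.
Proof.
rewrite /mdiff -sumrN; apply: eq_bigr => i _.
by rewrite mderivN mevalN mulNr.
Qed.

Lemma mdiffZ n (c : k) (F : {mpoly k[n.+1]}) x v :
  mdiff (c *: F) x v = c * mdiff F x v.
Proof. by rewrite -mul_mpolyC mdiffM mdiffC mevalC mul0r add0r. Qed.

Lemma mdiffZr n (F : {mpoly k[n.+1]}) x (a : k) v :
  mdiff F x (a *: v) = a * mdiff F x v.
Proof.
by rewrite /mdiff mulr_sumr; apply: eq_bigr => i _; rewrite mxE; ring.
Qed.

Lemma frac_diff_lin n (F G : {mpoly k[n.+1]}) x (a : k) v w :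
  frac_diff F G x (a *: v + w) = a * frac_diff F G x v + frac_diff F G x w.
Proof. by rewrite /frac_diff !mdiff_lin; ring. Qed.

Lemma frac_diffZ n (F G : {mpoly k[n.+1]}) x (a : k) v :
  frac_diff F G x (a *: v) = a * frac_diff F G x v.
Proof. by rewrite /frac_diff !mdiffZr; ring. Qed.

Lemma frac_diff_radial n d (F G : {mpoly k[n.+1]}) x :
  F \is d.-homog -> G \is d.-homog -> frac_diff F G x x = 0.
Proof.
move=> Fd Gd; rewrite /frac_diff (euler_identity _ Fd) (euler_identity _ Gd).
by rewrite [X in X / _](_ : _ = 0) ?mul0r//; ring.
Qed.

Lemma frac_val_scale n d (F G : {mpoly k[n.+1]}) (a : k) x : a != 0 ->
  F \is d.-homog -> G \is d.-homog -> frac_val F G (a *: x) = frac_val F G x.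
Proof.
move=> a0 Fd Gd; rewrite /frac_val (dhomog_scale _ _ Fd) (dhomog_scale _ _ Gd).
by rewrite -mulf_div divff ?mul1r ?expf_neq0.
Qed.

Lemma frac_diff_scale n d (F G : {mpoly k[n.+1]}) (a : k) x v : a != 0 ->
  F \is d.-homog -> G \is d.-homog ->
  frac_diff F G (a *: x) (a *: v) = frac_diff F G x v.
Proof.
move=> a0 Fd Gd; rewrite /frac_diff !(mdiff_scale _ _ _ Fd) !(mdiff_scale _ _ _ Gd).
rewrite (dhomog_scale _ _ Fd) (dhomog_scale _ _ Gd) exprMn.
rewrite -[RHS]mul1r -(divff (expf_neq0 2 (expf_neq0 d a0))) mulf_div.
by congr (_ / _); ring.
Qed.

(** The contraction of dF with a polynomial vector field. *)
Definition contract n (F : {mpoly k[n.+1]}) (tau : 'I_n.+1 -> {mpoly k[n.+1]}) :=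
  \sum_i F^`M(i) * tau i.

Lemma meval_contract n (F : {mpoly k[n.+1]}) tau (x : 'rV[k]_n.+1) :
  (contract F tau).@[x 0] = mdiff F x (\row_j (tau j).@[x 0]).
Proof.
rewrite /contract (big_morph _ (mevalD (x 0)) (meval0 (x 0))).
by apply: eq_bigr => i _; rewrite mevalM mxE.
Qed.

Lemma dhomog_contract n d e (F : {mpoly k[n.+1]}) tau :
  F \is d.-homog -> (forall i, tau i \is e.-homog) ->
  contract F tau \is (d.-1 + e).-homog.
Proof.
by move=> Fd te; apply: rpred_sum => i _; apply: dhomogM => //; apply: dhomog_mderiv.
Qed.

Definition fraction_near n (X : set 'rV[k]_n.+1) (phi : 'rV[k]_n.+1 -> k)
    (x : 'rV[k]_n.+1) :=
  exists N D : {mpoly k[n.+1]}, D.@[x 0] != 0 /\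
    forall y, X y -> D.@[y 0] != 0 -> phi y = N.@[y 0] / D.@[y 0].

Lemma fraction_near_sum n (X : set 'rV[k]_n.+1) (I : Type) (s : seq I)
    (phi : I -> 'rV[k]_n.+1 -> k) x :
  (forall i, fraction_near X (phi i) x) ->
  fraction_near X (fun y => \sum_(i <- s) phi i y) x.
Proof.
move=> Hphi; elim: s => [|i s [N [D [D0 HND]]]].
  exists 0, 1; rewrite meval1 oner_eq0; split=> // y _ _.
  by rewrite big_nil meval0 mul0r.
have [N' [D' [D'0 HND']]] := Hphi i.
exists (N' * D + N * D'), (D' * D); rewrite mevalM mulf_neq0//; split=> // y Xy.
rewrite mevalD !mevalM mulf_eq0 negb_or => /andP[D'y Dy].
by rewrite big_cons HND// HND'// addf_div.
Qed.

(** Evaluated on a polynomial tangent field, a regular form becomes a function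
   with local expressions as fractions; the quotient by a coordinate compensates
   for the degree of the field. *)
Lemma regular_form_fraction n (X : set 'rV[k]_n.+1) w
    (tau : 'I_n.+1 -> {mpoly k[n.+1]}) (j : 'I_n.+1) x :
  regular_form X w ->
  (forall y, X y -> cone_tangent X y (\row_i (tau i).@[y 0])) ->
  X x -> x 0 j != 0 ->
  fraction_near X (fun y => w y (\row_i (tau i).@[y 0]) / y 0 j) x.
Proof.
move=> wreg tauX Xx xj; have [m [A [B [G [H [regx Hw]]]]]] := wreg x Xx.
pose phi i y := frac_val (A i) (B i) y *
  frac_diff (G i) (H i) y (\row_i (tau i).@[y 0]) / y 0 j.
have [|N [D [D0 HND]]] := @fraction_near_sum _ X _ (index_enum 'I_m) phi x.
  move=> i; have [[Bx _] [Hx _]] := regx i.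
  exists (A i * (contract (G i) tau * H i - G i * contract (H i) tau)).
  exists (B i * H i ^+ 2 * 'X_j).
  rewrite !mevalR !mulf_neq0 ?expf_neq0//; split=> // y Xy.
  rewrite !mevalR !mulf_eq0 !negb_or => /andP[/andP[By Hy] yj].
  rewrite /phi /frac_val /frac_diff !meval_contract.
  by case/andP: Hy => Hy _; field; rewrite yj Hy.
exists (N * \prod_i (B i * H i)), (D * \prod_i (B i * H i)).
have prodE y : (\prod_i (B i * H i)).@[y 0] = \prod_i ((B i).@[y 0] * (H i).@[y 0]).
  rewrite (big_morph _ (mevalM (y 0)) (meval1 (y 0))).
  by apply: eq_bigr => i _; rewrite mevalM.
have P0 : \prod_i ((B i).@[x 0] * (H i).@[x 0]) != 0.
  by apply/prodf_neq0 => i _; have [[Bx _] [Hx _]] := regx i; rewrite mulf_neq0.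
rewrite mevalM prodE mulf_neq0//; split=> // y Xy.
rewrite !mevalM !prodE mulf_eq0 negb_or => /andP[Dy Py].
rewrite -mulf_div divff// mulr1 -HND// Hw//; last exact: tauX.
  by rewrite mulr_suml.
move=> i; apply/andP; rewrite -negb_or -mulf_eq0.
by move/prodf_neq0: Py; apply.
Qed.

End Fractions.

Section Span2.
Local Open Scope ring_scope.
Variable k : fieldType.

Lemma sub_col_mx2P n (x y v : 'rV[k]_n) :
  (v <= col_mx x y)%MS <-> exists a b, v = a *: x + b *: y.
Proof.
rewrite -addsmxE; split=> [/sub_addsmxP[[a b] ->]|[a [b ->]]].
  exists (a 0 0), (b 0 0).
  by rewrite [a in LHS]mx11_scalar [b in LHS]mx11_scalar !mul_scalar_mx.
by rewrite addmx_sub_adds// scalemx_sub.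
Qed.

Lemma row_free_col_mx2 n (x y : 'rV[k]_n) :
  (forall a b, a *: x + b *: y = 0 -> a = 0 /\ b = 0) ->
  row_free (col_mx x y).
Proof.
move=> H; rewrite -kermx_eq0; apply/rowV0P => u /sub_kermxP.
rewrite -[u]hsubmxK mul_row_col [lsubmx u]mx11_scalar [rsubmx u]mx11_scalar.
by rewrite !mul_scalar_mx => /H[-> ->]; rewrite -scalemx1 scale0r row_mx0.
Qed.

End Span2.

(** * Tangent lines of the cubic *)

Section GenusOne.
Local Open Scope classical_set_scope.
Local Open Scope ring_scope.
Variable k : closedFieldType.
Hypothesis char0 : forall n, (n%:R == 0 :> k) = (n == 0)%N.

Definition dW (i : 'I_3) : {mpoly k[3]} := tuple3
  (- (12 *: 'X_i0 ^+ 2 + 18 *: ('X_i0 * 'X_i2) + 4 *: 'X_i2 ^+ 2))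
  (2 *: ('X_i1 * 'X_i2))
  ('X_i1 ^+ 2 - (9 *: 'X_i0 ^+ 2 + 8 *: ('X_i0 * 'X_i2))) i.

Lemma dW_homog i : dW i \is 2.-homog.
Proof. by elim/ord3_ind: i; rewrite /dW /tuple3/=; dhom. Qed.

Definition grad (i : 'I_3) (x : 'rV[k]_3) : k := (dW i).@[x 0].

Lemma gradE0 x : grad i0 x =
  - (12 * x 0 i0 ^+ 2 + 18 * (x 0 i0 * x 0 i2) + 4 * x 0 i2 ^+ 2).
Proof. by rewrite /grad !mevalR. Qed.

Lemma gradE1 x : grad i1 x = 2 * (x 0 i1 * x 0 i2).
Proof. by rewrite /grad !mevalR. Qed.

Lemma gradE2 x : grad i2 x =
  x 0 i1 ^+ 2 - (9 * x 0 i0 ^+ 2 + 8 * (x 0 i0 * x 0 i2)).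
Proof. by rewrite /grad !mevalR. Qed.

Lemma mdiff_W (x v : 'rV[k]_3) : mdiff (W k) x v =
  grad i0 x * v 0 i0 + grad i1 x * v 0 i1 + grad i2 x * v 0 i2.
Proof.
rewrite /W !exprS !expr0 !(mdiffD, mdiffN, mdiffZ, mdiffM, mdiffX) -mpolyC1 !mdiffC.
by rewrite !mevalR gradE0 gradE1 gradE2; ring.
Qed.

Lemma grad_radial x : E x ->
  grad i0 x * x 0 i0 + grad i1 x * x 0 i1 + grad i2 x * x 0 i2 = 0.
Proof.
by case=> _ Wx; rewrite -mdiff_W (euler_identity _ (W_homog k)) Wx mulr0.
Qed.

(** A singular affine point would be a multiple root of g, but at a root other
   than 0 the derivative of g is a nonzero multiple of 9 t + 8, and
   - 81 (4 t^2 + 9 t + 4) + (36 t + 49) (9 t + 8) = 68. *)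
Lemma grad_neq0 x : E x -> exists i, grad i x != 0.
Proof.
move=> Ex; apply: contrapT => noi.
have D0 i : grad i x = 0 by apply/eqP; apply: contra_notT noi => ?; exists i.
have [x2|x2] := eqVneq (x 0 i2) 0.
  have [x0 /eqP[]] := E_infinite_part char0 Ex x2; apply/eqP.
  by have /eqP := D0 i2; rewrite gradE2 x0 x2 expr0n/= !(mul0r, mulr0, addr0) subr0 expf_eq0.
have x1 : x 0 i1 = 0.
  have /eqP := D0 i1; rewrite gradE1 !mulf_eq0 (negPf x2) orbF char0/=.
  by move/eqP.
have := D0 i0; rewrite gradE0; move/eqP; rewrite oppr_eq0 => /eqP e0.
have [_ Wx] := Ex; move: Wx; rewrite W_val x1 => Wx.
have : x 0 i0 * (4 * x 0 i0 ^+ 2 + 9 * (x 0 i0 * x 0 i2) + 4 * x 0 i2 ^+ 2) = 0.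
  by rewrite -[RHS]oppr0 -Wx; ring.
move/eqP; rewrite mulf_eq0 => /orP[/eqP x0|/eqP P0].
  move/eqP: e0; rewrite x0 expr0n/= !(mul0r, mulr0, add0r).
  by rewrite mulf_eq0 char0/= expf_eq0/= (negPf x2).
have /eqP : x 0 i2 * (9 * x 0 i0 + 8 * x 0 i2) = 0.
  rewrite -[RHS](subrr 0) -[X in X - _](mulr0 3) -{1}P0 -e0; ring.
rewrite mulf_eq0 (negPf x2)/= => /eqP L0.
have /eqP : 68 * x 0 i2 ^+ 2 = 0.
  transitivity (- 81 * (4 * x 0 i0 ^+ 2 + 9 * (x 0 i0 * x 0 i2) + 4 * x 0 i2 ^+ 2) +
    (36 * x 0 i0 + 49 * x 0 i2) * (9 * x 0 i0 + 8 * x 0 i2)); first by ring.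
  by rewrite P0 L0 !mulr0 addr0.
by rewrite mulf_eq0 char0/= expf_eq0/= (negPf x2).
Qed.

Definition cross (x v : 'rV[k]_3) : 'rV[k]_3 := vec3
  (x 0 i1 * v 0 i2 - x 0 i2 * v 0 i1)
  (x 0 i2 * v 0 i0 - x 0 i0 * v 0 i2)
  (x 0 i0 * v 0 i1 - x 0 i1 * v 0 i0).

(** The Poincare residue: for v tangent at x the vectors cross x v and grad x are
   both orthogonal to x and v, hence proportional, and omega x v is their
   ratio. *)
Definition omega (x v : 'rV[k]_3) : k :=
  if [pick i | grad i x != 0] is Some i then cross x v 0 i / grad i x else 0.

Lemma omega_cross x v i : E x -> mdiff (W k) x v = 0 ->
  cross x v 0 i = omega x v * grad i x.
Proof.
move=> Ex; rewrite mdiff_W => tv; have rx := grad_radial Ex; rewrite /omega.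
case: pickP => [j gj|nog]; last first.
  by have [j] := grad_neq0 Ex; rewrite nog.
rewrite mulrAC; apply: (mulIf gj); rewrite divfK//; apply/eqP; rewrite -subr_eq0.
apply/eqP; move: rx tv.
set a := grad i0 x; set b := grad i1 x; set c := grad i2 x => rx tv.
(* Each cross_i grad_j - cross_j grad_i is such a combination of the two
   orthogonality relations. *)
pose L p q := p * (a * x 0 i0 + b * x 0 i1 + c * x 0 i2) +
   q * (a * v 0 i0 + b * v 0 i1 + c * v 0 i2).
have L0 p q : L p q = 0 by rewrite /L rx tv !mulr0 addr0.
elim/ord3_ind: i; elim/ord3_ind: j {gj}; rewrite !vec3E -/a -/b -/c; first [ring
 | by rewrite -(L0 (v 0 i0) (- x 0 i0)) /L; ring
 | by rewrite -(L0 (- v 0 i0) (x 0 i0)) /L; ring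
 | by rewrite -(L0 (v 0 i1) (- x 0 i1)) /L; ring
 | by rewrite -(L0 (- v 0 i1) (x 0 i1)) /L; ring
 | by rewrite -(L0 (v 0 i2) (- x 0 i2)) /L; ring
 | by rewrite -(L0 (- v 0 i2) (x 0 i2)) /L; ring ].
Qed.

(** Two polynomial tangent fields, the cross products of the gradient with the
   third and with the second basis vector; the first spans the tangent line at
   the affine points, the second at the point at infinity. *)
Definition field2 (i : 'I_3) : {mpoly k[3]} := tuple3 (dW i1) (- dW i0) 0 i.
Definition field1 (i : 'I_3) : {mpoly k[3]} := tuple3 (- dW i2) 0 (dW i0) i.

Definition tau2 (x : 'rV[k]_3) := \row_i (field2 i).@[x 0].
Definition tau1 (x : 'rV[k]_3) := \row_i (field1 i).@[x 0].

Lemma tau2E x : tau2 x = vec3 (grad i1 x) (- grad i0 x) 0.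
Proof. by rewrite /tau2 row_tuple3 mevalN meval0. Qed.

Lemma tau1E x : tau1 x = vec3 (- grad i2 x) 0 (grad i0 x).
Proof. by rewrite /tau1 row_tuple3 mevalN meval0. Qed.

Lemma tau2_tangent x : mdiff (W k) x (tau2 x) = 0.
Proof. by rewrite mdiff_W tau2E !vec3E; ring. Qed.

Lemma tau1_tangent x : mdiff (W k) x (tau1 x) = 0.
Proof. by rewrite mdiff_W tau1E !vec3E; ring. Qed.

(** Modulo x the two fields are proportional, because x, tau1 x and tau2 x all lie
   in the plane orthogonal to the gradient. *)
Lemma tau12 x : E x ->
  x 0 i1 *: tau2 x = x 0 i2 *: tau1 x + - grad i0 x *: x.
Proof.
move=> /grad_radial rx; rewrite tau2E tau1E.
apply: row3P; rewrite !mxE/=; [|ring|ring].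
by rewrite -[RHS]add0r -rx; ring.
Qed.

Lemma omega_tau2 x : E x -> omega x (tau2 x) = x 0 i2.
Proof.
move=> Ex; have [i gi] := grad_neq0 Ex; apply: (mulIf gi).
rewrite -(omega_cross _ Ex (tau2_tangent x)) tau2E.
have rx := grad_radial Ex.
elim/ord3_ind: i {gi}; rewrite !vec3E; [ring|ring|].
by rewrite -[LHS]addr0 -rx; ring.
Qed.

Lemma omega_tau1 x : E x -> omega x (tau1 x) = x 0 i1.
Proof.
move=> Ex; have [i gi] := grad_neq0 Ex; apply: (mulIf gi).
rewrite -(omega_cross _ Ex (tau1_tangent x)) tau1E.
have rx := grad_radial Ex.
elim/ord3_ind: i {gi}; rewrite !vec3E; [ring| |ring].
by rewrite -[LHS]addr0 -rx; ring.
Qed.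

Lemma tangent_decomp2 x v : E x -> x 0 i2 != 0 -> mdiff (W k) x v = 0 ->
  v = (v 0 i2 / x 0 i2) *: x + (omega x v / x 0 i2) *: tau2 x.
Proof.
move=> Ex x2 tv; rewrite tau2E.
have c0 := omega_cross i0 Ex tv; have c1 := omega_cross i1 Ex tv.
move: c0 c1; rewrite !vec3E => c0 c1.
apply: row3P; rewrite !mxE/=; apply: (mulIf x2); rewrite mulrDl.
- by rewrite [_ / _ * _ * _]mulrAC divfK// [X in _ + X]mulrAC divfK// -c1; ring.
- by rewrite [_ / _ * _ * _]mulrAC divfK// [X in _ + X]mulrAC divfK// mulrN -c0; ring.
by rewrite [_ / _ * _ * _]mulrAC divfK// [X in _ + X]mulrAC divfK// mulr0 addr0.
Qed.

Lemma tangent_decomp1 x v : E x -> x 0 i1 != 0 -> mdiff (W k) x v = 0 ->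
  v = (v 0 i1 / x 0 i1) *: x + (omega x v / x 0 i1) *: tau1 x.
Proof.
move=> Ex x1 tv; rewrite tau1E.
have c0 := omega_cross i0 Ex tv; have c2 := omega_cross i2 Ex tv.
move: c0 c2; rewrite !vec3E => c0 c2.
apply: row3P; rewrite !mxE/=; apply: (mulIf x1); rewrite mulrDl.
- by rewrite [_ / _ * _ * _]mulrAC divfK// [X in _ + X]mulrAC divfK// mulrN -c2; ring.
- by rewrite [_ / _ * _ * _]mulrAC divfK// [X in _ + X]mulrAC divfK// mulr0 addr0.
by rewrite [_ / _ * _ * _]mulrAC divfK// [X in _ + X]mulrAC divfK// -c0; ring.
Qed.

(** On affine points a field acts on polynomials through their reduction, so it
   kills those that vanish on the curve; the relation between the two fields
   carries this to the other one, and density to the point at infinity. *)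
Lemma fields_kill d (F : {mpoly k[3]}) : F \is d.-homog ->
  (forall x, E x -> F.@[x 0] = 0) ->
  forall x, E x -> mdiff F x (tau2 x) = 0 /\ mdiff F x (tau1 x) = 0.
Proof.
move=> Fd F0; have [a Ha] := reduction F.
have a0 : a = 0.
  apply: (cval_dense (two_neq0 char0) (deg_g char0) (oner_neq0 _)) => t s st _.
  by have [<- _] := Ha t s st; apply/F0/aff_in.
have kill2 t s : s ^+ 2 = (g k).[t] -> mdiff F (aff t s) (tau2 (aff t s)) = 0.
  move=> st; have [_] := Ha t s st; rewrite a0 /= derivC !horner0 !(mulr0, mul0r) !addr0.
  move=> <-; congr mdiff; rewrite tau2E gradE0 gradE1 dg_val !vec3E.
  by congr vec3; ring.
have hom2 i : field2 i \is 2.-homog.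
  elim/ord3_ind: i; rewrite /field2 /tuple3/=; [|rewrite dhomogN|];
    by rewrite ?dW_homog ?dhomog0.
have hom1 i : field1 i \is 2.-homog.
  elim/ord3_ind: i; rewrite /field1 /tuple3/=; [rewrite dhomogN| |];
    by rewrite ?dW_homog ?dhomog0.
move=> x Ex; rewrite -!meval_contract; split.
  apply: (E_dense char0 (dhomog_contract Fd hom2) (oner_neq0 _)) Ex => t s st _.
  by rewrite meval_contract kill2.
apply: (E_dense char0 (dhomog_contract Fd hom1) (oner_neq0 _)) Ex => t s st _.
have Eat := (aff_in t s).1 st.
have := congr1 (mdiff F (aff t s)) (tau12 Eat).
rewrite mdiff_lin !mdiffZr kill2// (euler_identity _ Fd) F0// !mulr0 addr0.
by rewrite vec3E mul1r meval_contract.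
Qed.

Lemma cone_tangentP x v : E x -> cone_tangent E x v <-> mdiff (W k) x v = 0.
Proof.
move=> Ex; split=> [|tv d F Fd F0].
  by apply; [exact: W_homog|move=> y []].
have [k2 k1] := fields_kill Fd F0 Ex.
have [x2|x2] := eqVneq (x 0 i2) 0; last first.
  rewrite (tangent_decomp2 Ex x2 tv) mdiff_lin mdiffZr (euler_identity _ Fd) F0//.
  by rewrite k2 !mulr0 addr0.
have [_ x1] := E_infinite_part char0 Ex x2.
rewrite (tangent_decomp1 Ex x1 tv) mdiff_lin mdiffZr (euler_identity _ Fd) F0//.
by rewrite k1 !mulr0 addr0.
Qed.

Lemma tangent_plane (x tau : 'rV[k]_3) j : E x -> x 0 j != 0 -> tau 0 j = 0 ->
  tau != 0 -> mdiff (W k) x tau = 0 ->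
  (forall v, mdiff (W k) x v = 0 -> exists a b, v = a *: x + b *: tau) ->
  exists T : 'M[k]_(2, 3), row_free T /\
    (forall v, cone_tangent E x v <-> (v <= T)%MS).
Proof.
move=> Ex xj tj tau0 ttau dec; exists (col_mx x tau : 'M_(1 + 1, 3)); split.
  apply: row_free_col_mx2 => a b e.
  have a0 : a = 0.
    have /eqP := congr1 (fun v : 'rV[k]_3 => v 0 j) e.
    by rewrite !mxE tj mulr0 addr0 mulf_eq0 (negPf xj) orbF => /eqP.
  split=> //; move/eqP: e; rewrite a0 scale0r add0r scaler_eq0 (negPf tau0) orbF.
  by move/eqP.
move=> v; rewrite sub_col_mx2P cone_tangentP//; split; first exact: dec.
move=> [a [b ->]]; rewrite mdiff_lin mdiffZr ttau (euler_identity _ (W_homog k)).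
by case: Ex => _ ->; rewrite !mulr0 addr0.
Qed.

Lemma E_smooth : smooth_projective_curve (@E k).
Proof.
split=> [|x Ex]; first exact: E_curve.
have rx := grad_radial Ex; have [i gi] := grad_neq0 Ex.
have [x2|x2] := eqVneq (x 0 i2) 0; last first.
  apply: (@tangent_plane x (tau2 x) i2) => //.
  - by rewrite tau2E vec3E.
  - rewrite tau2E vec3_eq0 oppr_eq0 eqxx andbT; apply: contraNN gi.
    move=> /andP[/eqP e1 /eqP e0]; elim/ord3_ind: i; rewrite ?e0 ?e1//.
    by move/eqP: rx; rewrite e0 e1 !mul0r !add0r mulf_eq0 (negPf x2) orbF.
  - exact: tau2_tangent.
  move=> v tv; do 2!eexists; exact: tangent_decomp2.
have [x0 x1] := E_infinite_part char0 Ex x2.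
apply: (@tangent_plane x (tau1 x) i1) => //.
- by rewrite tau1E vec3E.
- rewrite tau1E vec3_eq0 oppr_eq0 eqxx /=; apply: contraNN gi.
  move=> /andP[/eqP e2 /eqP e0]; elim/ord3_ind: i; rewrite ?e0 ?e2//.
  by move/eqP: rx; rewrite e0 e2 !mul0r add0r addr0 mulf_eq0 (negPf x1) orbF.
- exact: tau1_tangent.
move=> v tv; do 2!eexists; exact: tangent_decomp1.
Qed.

End GenusOne.

(** * The regular forms of the cubic *)

Section Forms.
Local Open Scope classical_set_scope.
Local Open Scope ring_scope.
Variable k : closedFieldType.
Hypothesis char0 : forall n, (n%:R == 0 :> k) = (n == 0)%N.

Lemma regular_form_local1 n (X : set 'rV[k]_n.+1) w x :
  X x -> (exists d e (A B G H : {mpoly k[n.+1]}),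
    [/\ A \is d.-homog, B \is d.-homog, G \is e.-homog & H \is e.-homog] /\
    [/\ B.@[x 0] != 0, H.@[x 0] != 0 & forall y v, X y -> cone_tangent X y v ->
     B.@[y 0] != 0 -> H.@[y 0] != 0 ->
     w y v = frac_val A B y * frac_diff G H y v]) ->
  exists (m : nat) (A B G H : 'I_m -> {mpoly k[n.+1]}),
    (forall i, regular_frac (A i) (B i) x /\ regular_frac (G i) (H i) x) /\
    (forall y v, X y ->
       (forall i, (B i).@[y 0] != 0 /\ (H i).@[y 0] != 0) ->
       cone_tangent X y v ->
       w y v =
         \sum_(i < m) frac_val (A i) (B i) y * frac_diff (G i) (H i) y v).
Proof.
move=> Xx [d [e [A [B [G [H [[Ad Bd Ge He] [Bx Hx Hw]]]]]]]].
exists 1%N, (fun=> A), (fun=> B), (fun=> G), (fun=> H); split.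
  by move=> _; split; split=> //; [exists d|exists e].
move=> y v Xy /(_ ord0)[By Hy] tv; rewrite big_ord_recl big_ord0 addr0.
exact: Hw.
Qed.

(** When grad_j and x_i do not vanish, omega is x_i^2 / grad_j times the
   differential of a ratio of coordinates with denominator x_i, up to sign. *)
Lemma omega_regular : regular_form (@E k) (@omega k).
Proof.
move=> x Ex; apply: regular_form_local1 => //.
have rx := grad_radial Ex; have [i gi] := grad_neq0 char0 Ex.
have XX (j : 'I_3) : ('X_j ^+ 2 : {mpoly k[3]}) \is 2.-homog by dhom.
have [x2|x2] := eqVneq (x 0 i2) 0.
  have [x0 x1] := E_infinite_part char0 Ex x2.
  exists 2%N, 1%N, (- 'X_i1 ^+ 2), (dW k i2), 'X_i0, 'X_i1.
  split; first by split; [apply/dhomN/XX|exact: dW_homog|exact: dhomXU|exact: dhomXU].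
  rewrite mevalXU; split=> //.
    by rewrite -/(grad i2 x) gradE2 x0 x2 expr0n/= !(mul0r, mulr0) addr0 subr0 expf_neq0.
  move=> y v Ey; rewrite (cone_tangentP char0 _ Ey) => tv; rewrite -/(grad i2 y) mevalXU => g2 y1.
  have := omega_cross char0 i2 Ey tv; rewrite vec3E => c2.
  rewrite /frac_val /frac_diff !mdiffX -/(grad i2 y) !mevalR; apply: (mulIf g2).
  by rewrite -c2; move: (grad _ _) g2 => c g2; field; rewrite y1 g2.
have [g0|g0] := eqVneq (grad i0 x) 0; last first.
  exists 2%N, 1%N, (- 'X_i2 ^+ 2), (dW k i0), 'X_i1, 'X_i2.
  split; first by split; [apply/dhomN/XX|exact: dW_homog|exact: dhomXU|exact: dhomXU].
  rewrite mevalXU; split=> //.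
  move=> y v Ey; rewrite (cone_tangentP char0 _ Ey) => tv; rewrite -/(grad i0 y) mevalXU => g0' y2.
  have := omega_cross char0 i0 Ey tv; rewrite vec3E => c0.
  rewrite /frac_val /frac_diff !mdiffX -/(grad i0 y) !mevalR; apply: (mulIf g0').
by rewrite -c0; move: (grad _ _) g0' => c g0'; field; rewrite y2 g0'.
exists 2%N, 1%N, ('X_i2 ^+ 2), (dW k i1), 'X_i0, 'X_i2.
split; first by split; [exact: XX|exact: dW_homog|exact: dhomXU|exact: dhomXU].
rewrite mevalXU; split=> //.
  rewrite -/(grad i1 x); apply: contraNneq gi => g1; elim/ord3_ind: i; rewrite ?g0 ?g1//.
  by move/eqP: rx; rewrite g0 g1 !mul0r !add0r mulf_eq0 (negPf x2) orbF.
move=> y v Ey; rewrite (cone_tangentP char0 _ Ey) => tv; rewrite -/(grad i1 y) mevalXU => g1 y2.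
have := omega_cross char0 i1 Ey tv; rewrite vec3E => c1.
rewrite /frac_val /frac_diff !mdiffX -/(grad i1 y) !mevalR; apply: (mulIf g1).
by rewrite -c1; move: (grad _ _) g1 => c g1; field; rewrite y2 g1.
Qed.

Lemma infinity_in : E (vec3 0 4 0 : 'rV[k]_3).
Proof.
split; last by rewrite W_val !vec3E; ring.
by rewrite vec3_eq0 !negb_and (char0 4) orbT.
Qed.

Lemma swap_aff0 : \row_j (swap k j).@[aff 0 0 0] = vec3 0 4 0 :> 'rV[k]_3.
Proof. by rewrite swap_aff; congr vec3; ring. Qed.

Lemma swap_affE t s : t != 0 -> s ^+ 2 = (g k).[t] ->
  vec3 s (4 * t ^+ 2 + 9 * t + 4) (t * s) 0 i1 != 0 -> s != 0.
Proof.
move=> t0 st; rewrite vec3E; apply: contra_neq => s0; apply: (mulfI t0).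
transitivity (g k).[t]; first by rewrite g_val; ring.
by rewrite -st s0 expr0n mulr0.
Qed.

(** At the point at infinity the local expression N / D of h is pulled back along
   [swap]; the extra factor X_1 removes the points where [swap] is the zero
   vector. *)
Lemma E_regular_constant (h : 'rV[k]_3 -> k) :
  (forall a x, a != 0 -> E x -> h (a *: x) = h x) ->
  (forall x, E x -> fraction_near E h x) ->
  exists c, forall x, E x -> h x = c.
Proof.
move=> hZ hreg; have [N [D [D0 HND]]] := hreg _ infinity_in.
have infX1 : ('X_i1 : {mpoly k[3]}).@[vec3 0 4 0 0] != 0.
  by rewrite mevalXU vec3E char0.
have near_inf t s : t != 0 -> s ^+ 2 = (g k).[t] ->
    (pullback (D * 'X_i1) (swap k)).@[aff t s 0] != 0 ->
    h (aff t^-1 (s / t ^+ 2)) = (pullback (N * 'X_i1) (swap k)).@[aff t s 0] /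
      (pullback (D * 'X_i1) (swap k)).@[aff t s 0].
  move=> t0 st; rewrite !meval_pullback swap_aff !mevalM !mevalXU.
  rewrite mulf_eq0 negb_or => /andP[D1 y1].
  have s0 := swap_affE t0 st y1; have ts0 := mulf_neq0 t0 s0.
  rewrite -mulf_div divff// mulr1; move: D1; rewrite (swap_swap t0 s0 st) => D1.
  have Eat := (aff_in _ _).1 (swap_on t0 st).
  rewrite -(hZ _ _ ts0 Eat) HND//.
  by apply: pclosed_same_point (E_closed k) _ Eat; exists (t * s).
have hreg' : regular_everywhere (g k) (fun t s => h (aff t s)).
  split=> [t s st|].
    have Eat := (aff_in t s).1 st; have [N1 [D1 [D1at HND1]]] := hreg _ Eat.
    have [a Ha] := meval_aff N1; have [b Hb] := meval_aff D1.
    exists a, b; rewrite -Hb//; split=> // t' s' st' _.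
    by rewrite -Ha// -Hb// => D1'; apply: HND1 => //; apply/aff_in.
  have [a Ha] := meval_aff (pullback (N * 'X_i1) (swap k)).
  have [b Hb] := meval_aff (pullback (D * 'X_i1) (swap k)).
  exists a, b; split.
    rewrite -Hb; last by rewrite g_val; ring.
    by rewrite meval_pullback swap_aff0 mevalM mulf_neq0.
  move=> t s st; rewrite hornerX -Ha// -Hb// => t0; exact: near_inf.
have g00 : (g k).[0] = 0 by rewrite g_val; ring.
have [c Hc] := regular_constant (two_neq0 char0) (deg_g char0) g00 (@swap_on k) hreg'.
exists c => x Ex; have [x2|x2] := eqVneq (x 0 i2) 0; last first.
  have [t [s [st ->]]] := E_finite_part Ex x2.
  by rewrite hZ// ?Hc//; apply/aff_in.
have [x0 x1] := E_infinite_part char0 Ex x2.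
have -> : x = (x 0 i1 / 4) *: vec3 0 4 0.
  rewrite scale_vec3 -[LHS]vec3_eta x0 x2; congr vec3; first by ring.
    by rewrite divfK// char0.
  by ring.
rewrite hZ; [|by rewrite mulf_neq0// invr_eq0 char0|exact: infinity_in].
rewrite HND//; last exact: infinity_in.
apply: (mulIf D0); rewrite divfK//; apply/eqP; rewrite -subr_eq0.
have /eqP : (pullback (D * 'X_i1 * (N - c *: D)) (swap k)).@[aff 0 0 0] = 0.
  have /(aff_dense char0) : 'X != 0 :> {poly k} by rewrite polyX_eq0.
  apply; last by rewrite g_val; ring.
  move=> t s st; rewrite hornerX => t0.
  have := near_inf _ _ t0 st; rewrite Hc ?swap_on// !meval_pullback swap_aff.
  rewrite !mevalM mevalB mevalZ.
  set d := D.@[_]; set n := N.@[_]; set v := meval _ 'X_i1.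
  have [->|dv] := eqVneq (d * v) 0; first by rewrite mul0r.
  move: (dv); rewrite mulf_eq0 negb_or => /andP[d0 v0] /(_ isT).
  by rewrite -mulf_div divff// mulr1 => ->; rewrite divfK// subrr mulr0.
by rewrite meval_pullback swap_aff0 !mevalM mevalB mevalZ !mulf_eq0 (negPf D0) (negPf infX1).
Qed.

Section RegularForm.
Variable u : 'rV[k]_3 -> 'rV[k]_3 -> k.
Hypothesis ureg : regular_form (@E k) u.

(** Near a point a regular form is a combination of differentials of functions
   of degree 0, hence linear in the vector, zero on the point itself, and
   invariant under scaling. *)
Lemma form_linear x a b v tau : E x -> mdiff (W k) x tau = 0 ->
  mdiff (W k) x v = 0 -> v = a *: x + b *: tau -> u x v = b * u x tau.
Proof.
move=> Ex /(cone_tangentP char0 _ Ex) ttau /(cone_tangentP char0 _ Ex) tv vE.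
have [m [A [B [G [H [regx Hu]]]]]] := ureg Ex.
have nz i : (B i).@[x 0] != 0 /\ (H i).@[x 0] != 0.
  by have [[Bx _] [Hx _]] := regx i.
rewrite !Hu// mulr_sumr; apply: eq_bigr => i _; rewrite vE.
have [_ [_ [e [Ge He]]]] := regx i.
rewrite frac_diff_lin (frac_diff_radial _ Ge He) mulr0 add0r.
by rewrite frac_diffZ; ring.
Qed.

Lemma form_scale a x v : a != 0 -> E x -> mdiff (W k) x v = 0 ->
  u (a *: x) (a *: v) = u x v.
Proof.
move=> a0 Ex tv; have [m [A [B [G [H [regx Hu]]]]]] := ureg Ex.
have Eax : E (a *: x) by apply: pclosed_same_point (E_closed k) _ Ex; exists a.
have tav : mdiff (W k) (a *: x) (a *: v) = 0.
  by rewrite (mdiff_scale _ _ _ (W_homog k)) tv mulr0.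
have nz i : (B i).@[x 0] != 0 /\ (H i).@[x 0] != 0.
  by have [[Bx _] [Hx _]] := regx i.
have nza i : (B i).@[(a *: x) 0] != 0 /\ (H i).@[(a *: x) 0] != 0.
  have [[Bx [d [_ Bd]]] [Hx [e [_ He]]]] := regx i.
  by rewrite (dhomog_scale _ _ Bd) (dhomog_scale _ _ He) !mulf_neq0 ?expf_neq0.
rewrite !Hu//; [|exact/cone_tangentP..]; apply: eq_bigr => i _.
have [[_ [d [Ad Bd]]] [_ [e [Ge He]]]] := regx i.
by rewrite (frac_val_scale _ a0 Ad Bd) (frac_diff_scale _ _ a0 Ge He).
Qed.

(** The quotient of u by omega, computed on a tangent vector where omega is known:
   omega x (tau2 x) = x_2 and omega x (tau1 x) = x_1. *)
Definition form_ratio (x : 'rV[k]_3) :=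
  if x 0 i2 != 0 then u x (tau2 x) / x 0 i2 else u x (tau1 x) / x 0 i1.

Lemma form_ratio1 x : E x -> x 0 i1 != 0 ->
  form_ratio x = u x (tau1 x) / x 0 i1.
Proof.
move=> Ex x1; rewrite /form_ratio; case: ifP => // x2.
have e := tangent_decomp1 char0 Ex x1 (tau2_tangent x).
rewrite (form_linear Ex (tau1_tangent x) (tau2_tangent x) e) (omega_tau2 char0 Ex).
by field; rewrite x1 x2.
Qed.

Lemma form_ratioE x v : E x -> mdiff (W k) x v = 0 ->
  u x v = form_ratio x * omega x v.
Proof.
move=> Ex tv; have [x2|x2] := eqVneq (x 0 i2) 0; last first.
  rewrite (form_linear Ex (tau2_tangent x) tv (tangent_decomp2 char0 Ex x2 tv)).
  by rewrite /form_ratio x2; ring.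
have [_ x1] := E_infinite_part char0 Ex x2.
rewrite (form_linear Ex (tau1_tangent x) tv (tangent_decomp1 char0 Ex x1 tv)).
by rewrite form_ratio1//; ring.
Qed.

Lemma form_ratio_scale a x : a != 0 -> E x -> form_ratio (a *: x) = form_ratio x.
Proof.
move=> a0 Ex; have [i gi] := grad_neq0 char0 Ex.
have Eax : E (a *: x) by apply: pclosed_same_point (E_closed k) _ Ex; exists a.
have grad_scale j : grad j (a *: x) = a ^+ 2 * grad j x.
  exact: dhomog_scale (dW_homog k j).
have [v tv v0] : exists2 v, mdiff (W k) x v = 0 & omega x v != 0.
  have [x2|x2] := eqVneq (x 0 i2) 0; last first.
    by exists (tau2 x); rewrite ?tau2_tangent ?omega_tau2.
  have [_ x1] := E_infinite_part char0 Ex x2.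
  by exists (tau1 x); rewrite ?tau1_tangent ?omega_tau1.
have tav : mdiff (W k) (a *: x) (a *: v) = 0.
  by rewrite (mdiff_scale _ _ _ (W_homog k)) tv mulr0.
have omega_scale : omega (a *: x) (a *: v) = omega x v.
  apply: (mulIf (mulf_neq0 (expf_neq0 2 a0) gi)); rewrite -{1}grad_scale.
  rewrite -(omega_cross char0 i Eax tav) mulrCA -(omega_cross char0 i Ex tv).
  by elim/ord3_ind: i {gi}; rewrite !vec3E !mxE; ring.
apply: (mulIf v0); rewrite -{1}omega_scale -!form_ratioE//.
exact: form_scale.
Qed.

Lemma form_ratio_near x : E x -> fraction_near E form_ratio x.
Proof.
move=> Ex; have [x2|x2] := eqVneq (x 0 i2) 0; last first.
  have [|N [D [D0 HND]]] := regular_form_fraction (tau := field2 k) ureg _ Ex x2.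
    by move=> y Ey; apply/cone_tangentP => //; exact: tau2_tangent.
  exists (N * 'X_i2), (D * 'X_i2); rewrite mevalM mevalXU mulf_neq0//.
  split=> // y Ey; rewrite !mevalM !mevalXU mulf_eq0 negb_or => /andP[Dy y2].
  by rewrite -mulf_div divff// mulr1 -HND// /form_ratio y2.
have [_ x1] := E_infinite_part char0 Ex x2.
have [|N [D [D0 HND]]] := regular_form_fraction (tau := field1 k) ureg _ Ex x1.
  by move=> y Ey; apply/cone_tangentP => //; exact: tau1_tangent.
exists (N * 'X_i1), (D * 'X_i1); rewrite mevalM mevalXU mulf_neq0//.
split=> // y Ey; rewrite !mevalM !mevalXU mulf_eq0 negb_or => /andP[Dy y1].
by rewrite -mulf_div divff// mulr1 -HND// form_ratio1.
Qed.

End RegularForm.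

Lemma E_genus : genus_eq (@E k) 1.
Proof.
exists (fun=> @omega k); split=> [_|c Hc i|u ureg]; first exact: omega_regular.
  have Ex := @infinity_in.
  have := Hc _ (tau1 (vec3 0 4 0)) Ex.
  rewrite (cone_tangentP char0 _ Ex) tau1_tangent => /(_ erefl).
  rewrite big_ord_recl big_ord0 addr0 omega_tau1// vec3E => /eqP.
  by rewrite mulf_eq0 char0 orbF (ord1 i) => /eqP.
have [c Hc] := E_regular_constant (form_ratio_scale ureg) (form_ratio_near ureg).
exists (fun=> c) => x v Ex /(cone_tangentP char0 _ Ex) tv.
by rewrite big_ord_recl big_ord0 addr0 (form_ratioE ureg Ex tv) Hc.
Qed.

End Forms.

(** * The equation of the period-5 curve *)

Section PeriodFive.
Local Open Scope classical_set_scope.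
Local Open Scope ring_scope.
Variable k : closedFieldType.

(** For a = 1 one has u = f(1) and f(u) = v / u^2; the quintic is u^4 times the
   numerator w^2 + b w + c of f(w) at w = f(u), made homogeneous by a. *)
Definition quintic (a b c : k) :=
  let u := a + b + c in let v := u ^+ 2 + b * u + c * a in
  a * v ^+ 2 + b * u ^+ 2 * v + c * u ^+ 4.

Lemma fnum_val (b c z : k) : (fnum b c).[z] = z ^+ 2 + b * z + c.
Proof. by rewrite /fnum !hornerR. Qed.

Lemma fden_val (z : k) : (fden k).[z] = z ^+ 2.
Proof. by rewrite /fden !hornerR. Qed.

Lemma size_fnum (b c : k) : size (fnum b c) = 3%N.
Proof.
rewrite /fnum -addrA size_polyDl size_polyXn// ltnS.
rewrite (leq_trans (size_polyD _ _))// geq_max (leq_trans (size_scale_leq _ _)) ?size_polyX//.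
by rewrite (leq_trans (size_polyC_leq1 _)).
Qed.

Lemma ratmap_infty (b c : k) : ratmap (fnum b c) (fden k) None = Some 1.
Proof.
rewrite /= size_fnum /fden size_polyXn /= coefXn eqxx oner_eq0 /fnum.
by rewrite !coefD coefXn coefZ coefX coefC/= mulr0 !addr0 divr1.
Qed.

Lemma ratmap_Some (b c z : k) : z != 0 ->
  ratmap (fnum b c) (fden k) (Some z) = Some ((z ^+ 2 + b * z + c) / z ^+ 2).
Proof. by move=> z0; rewrite /= fden_val fnum_val expf_eq0 (negPf z0) andbF. Qed.

Lemma ratmap_0 (b c : k) : ratmap (fnum b c) (fden k) (Some 0) = None.
Proof. by rewrite /= fden_val expr0n eqxx. Qed.

(** If c is nonzero, a point with u = 0 or f(u) = 0 does not satisfy the quintic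
   equation, so f^2(u) = 0 forces the exact period 5. *)
Lemma V5P b c : V_set k 5 (b, c) <-> c != 0 /\ quintic 1 b c = 0.
Proof.
rewrite /V_set /=; set f := ratmap (fnum b c) (fden k).
have f_0 : f (Some 0) = None := ratmap_0 b c.
have f_infty : f None = Some 1 := ratmap_infty b c.
have f_Some z (z0 : z != 0) := ratmap_Some b c z0 : f (Some z) = _.
clearbody f.
set u := 1 + b + c; set v := u ^+ 2 + b * u + c.
have f3 : iter 3 f (Some 0) = Some u.
  rewrite /= f_0 f_infty f_Some ?oner_neq0//.
  by congr Some; rewrite /u; field; rewrite oner_neq0.
have qE : quintic 1 b c = v ^+ 2 + b * u ^+ 2 * v + c * u ^+ 4.
  by rewrite /quintic mulr1 mul1r -/u -/v.
have quad : quadratic (fnum b c) (fden k) <-> c != 0.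
  rewrite /quadratic size_fnum size_polyXn /fden coprimep_pexpr// coprimepX.
  by rewrite /root fnum_val expr0n mulr0 !add0r; split=> [[]|].
split=> [[/quad c0 _ [_ per nper]]|[c0 q0]].
  split=> //; rewrite qE; have := per; rewrite 2!iterS f3.
  have [u0|u0] := eqVneq u 0.
    by rewrite u0 f_0 f_infty => -[] /eqP; rewrite oner_eq0.
  rewrite f_Some// -/v.
  have [v0|v0] := eqVneq (v / u ^+ 2) 0; first by rewrite v0 f_0.
  rewrite f_Some// => -[] /eqP; rewrite mulf_eq0 invr_eq0 expf_eq0/=.
  rewrite (negPf v0) orbF => /eqP e.
  transitivity (u ^+ 4 * ((v / u ^+ 2) ^+ 2 + b * (v / u ^+ 2) + c)).
    by field.
  by rewrite e mulr0.
have u0 : u != 0.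
  apply: contra_eq_neq q0 => u0; rewrite qE /v u0 !expr0n/= !(mulr0, mul0r, add0r, addr0).
  by rewrite expf_eq0.
have e : (v / u ^+ 2) ^+ 2 + b * (v / u ^+ 2) + c = 0.
  apply: (mulfI (expf_neq0 4 u0)); rewrite mulr0 -q0 qE; field; exact: u0.
have v0 : v / u ^+ 2 != 0.
  by apply: contra_eq_neq e => ->; rewrite expr0n mulr0 !add0r.
have f4 : iter 4 f (Some 0) = Some (v / u ^+ 2).
  by rewrite iterS f3 f_Some.
split; first exact/quad.
  rewrite /critical_point /root /fden derivXn !(hornerD, hornerN, hornerM, hornerMn).
  by rewrite !hornerXn; apply/eqP; ring.
split=> //; first by rewrite iterS f4 f_Some// e mul0r.
move=> [|[|[|[|[|m]]]]] // _; rewrite ?f4 ?f3.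
- by rewrite /= f_0.
- by rewrite /= f_0 f_infty => -[] /eqP; rewrite oner_eq0.
- by move=> -[] /eqP; rewrite (negPf u0).
by move=> -[] /eqP; rewrite (negPf v0).
Qed.

End PeriodFive.

(** * The parametrization and its inverse *)

Section Parametrization.
Local Open Scope classical_set_scope.
Local Open Scope ring_scope.
Variable k : closedFieldType.
Hypothesis char0 : forall n, (n%:R == 0 :> k) = (n == 0)%N.

Definition V5 : set 'rV[k]_3 := plane_embedding (V_set k 5).

(* u and v of [quintic], as forms in a, b, c *)
Definition formU : {mpoly k[3]} := 'X_i0 + 'X_i1 + 'X_i2.
Definition formV : {mpoly k[3]} := formU ^+ 2 + 'X_i1 * formU + 'X_i2 * 'X_i0.
Definition quintic_form : {mpoly k[3]} :=
  'X_i0 * formV ^+ 2 + 'X_i1 * formU ^+ 2 * formV + 'X_i2 * formU ^+ 4.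

Lemma quintic_form_homog : quintic_form \is 5.-homog.
Proof. by rewrite /quintic_form /formV /formU; dhom. Qed.

Lemma quintic_form_val (x : 'rV[k]_3) :
  quintic_form.@[x 0] = quintic (x 0 i0) (x 0 i1) (x 0 i2).
Proof. by rewrite !mevalR. Qed.

Lemma V5_equation (x : 'rV[k]_3) : V5 x <->
  [/\ x 0 i0 != 0, x 0 i2 != 0 & quintic (x 0 i0) (x 0 i1) (x 0 i2) = 0].
Proof.
have scale (a : k) : quintic_form.@[(a *: x) 0] = a ^+ 5 * quintic_form.@[x 0].
  exact: dhomog_scale quintic_form_homog.
split=> [[[b c] /V5P[c0 q0] /= [a a0 xE]]|[x0 x2 q0]].
  have -> : x = a *: vec3 1 b c by rewrite xE.
  rewrite scale_vec3 !vec3E mulr1 a0 mulf_neq0//; split=> //.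
  have := dhomog_scale a (vec3 1 b c) quintic_form_homog.
  by rewrite !quintic_form_val scale_vec3 !vec3E mulr1 q0 mulr0.
have xE : vec3 1 (x 0 i1 / x 0 i0) (x 0 i2 / x 0 i0) = (x 0 i0)^-1 *: x.
  by rewrite -[x in RHS]vec3_eta scale_vec3 !vec3E mulVf// ![_^-1 * _]mulrC.
exists (x 0 i1 / x 0 i0, x 0 i2 / x 0 i0).
  apply/V5P; split; first by rewrite mulf_neq0// invr_eq0.
  have := scale (x 0 i0)^-1; rewrite -xE !quintic_form_val !vec3E q0 mulr0.
  exact.
exists (x 0 i0) => //; rewrite -/(vec3 1 (x 0 i1 / x 0 i0) (x 0 i2 / x 0 i0)) xE.
by rewrite scalerA divff// scale1r.
Qed.

Lemma V5_neq0 x : V5 x -> x != 0.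
Proof.
by case/V5_equation=> x0 _ _; apply: contra_neq x0 => ->; rewrite mxE.
Qed.

(** On the affine curve, with T = t + 2 and y = 2 (1 - T) / (T - s), one has
   b + c = - 1 / T and b = - 1 - (s + T) / (2 T) - y; multiplication by 2 T (T - s)
   gives three quadratic forms.  They vanish simultaneously at the point
   T = s = 1, where the expression y = (s + T) / (2 (T^2 - 3 T + 1)) yields the
   cubic forms of the second chart. *)
Definition polT : {mpoly k[3]} := 'X_i0 + 2 *: 'X_i2.

Definition chart_a : {mpoly k[3]} := 2 *: (polT * (polT - 'X_i1)).
Definition chart_b : {mpoly k[3]} := ('X_i1 + polT) ^+ 2 - 4 *: (polT * 'X_i2).
Definition chart_c : {mpoly k[3]} := - (2 *: ((polT - 'X_i1) * 'X_i2)) - chart_b.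
Definition chart (i : 'I_3) := tuple3 chart_a chart_b chart_c i.

Definition polD : {mpoly k[3]} := polT ^+ 2 - 3 *: (polT * 'X_i2) + 'X_i2 ^+ 2.
Definition chart'_a : {mpoly k[3]} := 2 *: (polD * polT).
Definition chart'_b : {mpoly k[3]} :=
  - (2 *: (polD * polT)) - ('X_i1 + polT) * (polT - 'X_i2) ^+ 2.
Definition chart'_c : {mpoly k[3]} := - (2 *: (polD * 'X_i2)) - chart'_b.
Definition chart' (i : 'I_3) := tuple3 chart'_a chart'_b chart'_c i.

Definition param (x : 'rV[k]_3) := \row_i (chart i).@[x 0].
Definition param' (x : 'rV[k]_3) := \row_i (chart' i).@[x 0].
Definition paramf (x : 'rV[k]_3) := if param x == 0 then param' x else param x.

Lemma chart_homog i : chart i \is 2.-homog.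
Proof.
by elim/ord3_ind: i; rewrite /chart /tuple3/= /chart_c /chart_b /chart_a /polT; dhom.
Qed.

Lemma chart'_homog i : chart' i \is 3.-homog.
Proof.
by elim/ord3_ind: i;
  rewrite /chart' /tuple3/= /chart'_c /chart'_b /chart'_a /polD /polT; dhom.
Qed.

Definition tcoord (x : 'rV[k]_3) := x 0 i0 + 2 * x 0 i2.

Lemma paramE (x : 'rV[k]_3) (T := tcoord x) (s := x 0 i1) (r := x 0 i2)
    (b := (s + T) ^+ 2 - 4 * (T * r)) :
  param x = vec3 (2 * (T * (T - s))) b (- (2 * ((T - s) * r)) - b).
Proof. by rewrite /param row_tuple3 !mevalR. Qed.

Lemma param'E (x : 'rV[k]_3) (T := tcoord x) (s := x 0 i1) (r := x 0 i2)
    (D := T ^+ 2 - 3 * (T * r) + r ^+ 2)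
    (b := - (2 * (D * T)) - (s + T) * (T - r) ^+ 2) :
  param' x = vec3 (2 * (D * T)) b (- (2 * (D * r)) - b).
Proof. by rewrite /param' row_tuple3 !mevalR. Qed.

Definition weierstrass (T s r : k) :=
  s ^+ 2 * r - 4 * T ^+ 3 + 15 * T ^+ 2 * r - 16 * T * r ^+ 2 + 4 * r ^+ 3.

Lemma W_weierstrass (x : 'rV[k]_3) : (W k).@[x 0] = weierstrass (tcoord x) (x 0 i1) (x 0 i2).
Proof. by rewrite W_val /weierstrass /tcoord; ring. Qed.

(** The cofactor comes from the division of the composite polynomial by the
   Weierstrass form; those of the next lemmas come from similar divisions. *)
Lemma quintic_param x : E x -> quintic_form.@[param x 0] = 0.
Proof.
case=> _; rewrite W_weierstrass quintic_form_val paramE !vec3E.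
move: (tcoord x) (x 0 i1) (x 0 i2) => T s r Wx.
transitivity (weierstrass T s r * (s - T) ^+ 3 *
  (8 * T ^+ 4 - 16 * T ^+ 3 * s - 40 * T ^+ 3 * r + 8 * T ^+ 2 * s ^+ 2
   + 32 * T ^+ 2 * s * r + 40 * T ^+ 2 * r ^+ 2 - 24 * T * s ^+ 2 * r
   - 16 * T * s * r ^+ 2 + 8 * s ^+ 2 * r ^+ 2)); last by rewrite Wx !mul0r.
by rewrite /quintic /weierstrass; ring.
Qed.

Lemma param_minors x i j : E x -> param' x 0 i * param x 0 j = param' x 0 j * param x 0 i.
Proof.
case=> _; rewrite W_weierstrass paramE param'E.
move: (tcoord x) (x 0 i1) (x 0 i2) => T s r Wx.
have key (a b e : k) : a - b = weierstrass T s r * e -> a = b.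
  by rewrite Wx mul0r => /eqP; rewrite subr_eq0 => /eqP.
elim/ord3_ind: i; elim/ord3_ind: j; rewrite !vec3E //.
- by apply: (key _ _ (- 2 * T ^+ 2)); rewrite /weierstrass; ring.
- by apply: (key _ _ (2 * T ^+ 2)); rewrite /weierstrass; ring.
- by apply: (key _ _ (2 * T ^+ 2)); rewrite /weierstrass; ring.
- by apply: (key _ _ (- 2 * T * r)); rewrite /weierstrass; ring.
- by apply: (key _ _ (- 2 * T ^+ 2)); rewrite /weierstrass; ring.
by apply: (key _ _ (2 * T * r)); rewrite /weierstrass; ring.
Qed.

(** The open set where the first chart lands in the part a c != 0 of the plane,
   which contains the period-5 curve. *)
Definition base_open := chart_a * chart_c.

Lemma base_open_homog : base_open \is 4.-homog.
Proof. exact: dhomogM (chart_homog i0) (chart_homog i2). Qed.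

(** For a = 1 and e = b + c the inverse is T = - 1 / e and
   e (s + T) = 2 (e^2 + 3 e + 1) (1 + b) / (1 + e)^2. *)
Definition polE : {mpoly k[3]} := 'X_i1 + 'X_i2.
Definition inv_t : {mpoly k[3]} := - (formU ^+ 2 * 'X_i0).
Definition inv_r : {mpoly k[3]} := polE * formU ^+ 2.
Definition inv_s : {mpoly k[3]} :=
  2 *: ((polE ^+ 2 + 3 *: (polE * 'X_i0) + 'X_i0 ^+ 2) * ('X_i0 + 'X_i1)) - inv_t.
Definition inv (i : 'I_3) := tuple3 (inv_t - 2 *: inv_r) inv_s inv_r i.
Definition paraminv (x : 'rV[k]_3) := \row_i (inv i).@[x 0].

Lemma inv_homog i : inv i \is 3.-homog.
Proof.
by elim/ord3_ind: i;
  rewrite /inv /tuple3/= /inv_s /inv_r /inv_t /polE /formU; dhom.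
Qed.

Lemma paraminvE (x : 'rV[k]_3) (a := x 0 i0) (b := x 0 i1) (c := x 0 i2) (e := b + c)
  (u := a + b + c) (t := - (u ^+ 2 * a)) (r := e * u ^+ 2) :
  paraminv x = vec3 (t - 2 * r)
    (2 * ((e ^+ 2 + 3 * (e * a) + a ^+ 2) * (a + b)) - t) r.
Proof. by rewrite /paraminv row_tuple3 !mevalR. Qed.

(** Modulo the quintic, u, e and e^2 + 3 a e + a^2 are units on the period-5
   curve: if one of them vanishes, the quintic reduces to a monomial in a, c and
   e. *)
Lemma V5_paraminv x : V5 x -> [/\ E (paraminv x),
  base_open.@[paraminv x 0] != 0 & same_point (param (paraminv x)) x].
Proof.
move=> /V5_equation[].
set a := x 0 i0; set b := x 0 i1; set c := x 0 i2 => a0 c0 q0.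
pose e := b + c; pose u := a + e; pose P := e ^+ 2 + 3 * (e * a) + a ^+ 2.
have u0 : u != 0.
  apply: contra_eq_neq q0 => uE; have -> : quintic a b c = a ^+ 3 * c ^+ 2.
    rewrite /quintic (_ : a + b + c = u); last by rewrite /u /e; ring.
    by rewrite uE; ring.
  by rewrite mulf_neq0// expf_neq0.
have e0 : e != 0.
  apply: contra_eq_neq q0 => eE; have -> : quintic a b c = a ^+ 5.
    have -> : c = - b by apply/eqP; rewrite -addr_eq0 addrC; apply/eqP.
    by rewrite /quintic; ring.
  by rewrite expf_neq0.
have P0 : P != 0.
  apply: contra_eq_neq q0 => PE; have -> : quintic a b c =
      P * (b ^+ 2 * e + 3 * (a * b * e) + e ^+ 3 + 2 * (a * e ^+ 2) +
           4 * (a ^+ 2 * e) + a ^+ 3) + a ^+ 2 * e ^+ 2 * c.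
    by rewrite /quintic /P /e; ring.
  by rewrite PE mul0r add0r !mulf_neq0 ?expf_neq0.
pose t := - (u ^+ 2 * a); pose r := e * u ^+ 2; pose s := 2 * (P * (a + b)) - t.
have gE : paraminv x = vec3 (t - 2 * r) s r.
  by rewrite paraminvE /s /t /r /P /u /e -/a -/b -/c !addrA.
have tcoordE : tcoord (paraminv x) = t by rewrite /tcoord gE !vec3E; ring.
have r0 : r != 0 by rewrite mulf_neq0 ?expf_neq0.
have t0 : t != 0 by rewrite oppr_eq0 mulf_neq0 ?expf_neq0.
have Wg : weierstrass t s r = 0.
  transitivity (4 * P * u ^+ 2 * quintic a b c); last by rewrite q0 mulr0.
  by rewrite /weierstrass /quintic /s /t /r /P /u /e; ring.
have Eg : E (paraminv x).
  split; last by rewrite W_weierstrass tcoordE gE !vec3E.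
  by rewrite gE vec3_eq0 (negPf r0) !andbF.
have ts : t - s != 0.
  rewrite subr_eq0; apply: contra_eq_neq Wg => <-.
  have -> : weierstrass t t r = 4 * u ^+ 3 * (u ^+ 4 * P).
    by rewrite /weierstrass /t /r /P /u; ring.
  by rewrite !mulf_neq0 ?expf_neq0 ?char0.
pose A := 2 * (t * (t - s)).
have A0 : A != 0 by rewrite !mulf_neq0 ?char0.
pose B := (s + t) ^+ 2 - 4 * (t * r); pose C := - (2 * ((t - s) * r)) - B.
have pE : param (paraminv x) = vec3 A B C by rewrite paramE tcoordE gE !vec3E.
have aB : a * B = b * A.
  apply/eqP; rewrite -subr_eq0; apply/eqP.
  transitivity (4 * a ^+ 2 * quintic a b c); last by rewrite q0 mulr0.
  by rewrite /quintic /A /B /s /t /r /P /u /e; ring.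
have aC : a * C = c * A.
  have -> : a * C = - (2 * ((t - s) * r)) * a - a * B by rewrite /C; ring.
  by rewrite aB /A {2 4}/t /r /e; ring.
have pxE : x = (a / A) *: param (paraminv x).
  rewrite pE scale_vec3 -[LHS]vec3_eta -/a -/b -/c; congr vec3.
  - by rewrite divfK.
  - by apply: (mulIf A0); rewrite mulrAC divfK// aB.
  by apply: (mulIf A0); rewrite mulrAC divfK// aC.
split=> //; last by exists (a / A); rewrite // mulf_neq0 ?invr_eq0.
have := row_tuple3 chart_a chart_b chart_c (paraminv x).
rewrite -/(param _) pE => e3; rewrite /base_open mevalM.
have := congr1 (fun v : 'rV[k]_3 => v 0 i0) e3.
have := congr1 (fun v : 'rV[k]_3 => v 0 i2) e3; rewrite !vec3E => <- <-.
by rewrite mulf_neq0//; apply: contra_neq c0 => C0; apply: (mulIf A0);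
  rewrite -aC C0 mulr0 mul0r.
Qed.

Lemma base_openE (x : 'rV[k]_3) : base_open.@[x 0] = param x 0 i0 * param x 0 i2.
Proof. by rewrite mevalM !mxE. Qed.

(** Where a and c do not vanish one has T, T - s, r and T - r nonzero: T = r gives
   s = r or s = - r on the cubic, hence T = s or c = 0. *)
Lemma param_V5 x : E x -> base_open.@[x 0] != 0 ->
  V5 (param x) /\ same_point (paraminv (param x)) x.
Proof.
move=> Ex; rewrite base_openE mulf_eq0 negb_or => /andP[p0 p2].
have q0 := quintic_param Ex; rewrite quintic_form_val in q0.
split; first exact/V5_equation.
move: p0 p2 q0; have [_] := Ex; rewrite W_weierstrass.
rewrite paramE !vec3E paraminvE !vec3E; set T := tcoord x.
set s := x 0 i1; set r := x 0 i2 => Wx.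
set A := 2 * _; set B := _ - 4 * _; set C := - _ - B => A0 C0 _.
have T0 : T != 0 by apply: contra_neq A0 => T0; rewrite /A T0 mul0r mulr0.
have Ts : T - s != 0 by apply: contra_neq A0 => e; rewrite /A e !mulr0.
have r0 : r != 0.
  apply: contra_eq_neq Wx => r0.
  rewrite (_ : weierstrass T s r = - (4 * T ^+ 3)); last by rewrite /weierstrass r0; ring.
  by rewrite oppr_eq0 mulf_neq0 ?char0 ?expf_neq0.
have Tr : T - r != 0.
  apply: contra_neq C0 => /eqP; rewrite subr_eq0 => /eqP TE.
  have : (r * (T - s)) * (r + s) = 0.
    by rewrite -[RHS]oppr0 -Wx /weierstrass TE; ring.
  move/eqP; rewrite mulf_eq0 mulf_eq0 (negPf r0) (negPf Ts)/= addr_eq0 => /eqP rE.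
  by rewrite /C /B TE rE; ring.
pose l := - 2 * (T - s) * (A + B + C) ^+ 2.
have uE : A + B + C = 2 * ((T - s) * (T - r)) by rewrite /A /C; ring.
have l0 : l != 0.
  by rewrite /l uE !mulf_neq0 ?expf_neq0 ?oppr_eq0 ?char0// !mulf_neq0 ?char0.
apply: same_point_sym; exists l => //.
rewrite -[x in RHS]vec3_eta scale_vec3; congr vec3.
- have -> : x 0 i0 = T - 2 * r by rewrite /T /tcoord -/r; ring.
  by rewrite /l uE /A /C; ring.
- apply: (mulIf r0); apply/eqP; rewrite -subr_eq0; apply/eqP.
  transitivity (weierstrass T s r * (- 8 * T * r * (T - s) ^+ 2)).
    by rewrite /l uE /weierstrass /A /C /B -/s; ring.
  by rewrite Wx mul0r.
by rewrite /l uE /C -/r; ring.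
Qed.

End Parametrization.

(** * Birational equivalence *)

Section Birational.
Local Open Scope classical_set_scope.
Local Open Scope ring_scope.
Variable k : closedFieldType.
Hypothesis char0 : forall n, (n%:R == 0 :> k) = (n == 0)%N.

(** By irreducibility it is enough that a and c are nonzero at one point each. *)
Lemma base_open_nonempty : exists2 x : 'rV[k]_3, E x & (base_open k).@[x 0] != 0.
Proof.
apply: contrapT => noU.
have Ea : E (vec3 0 0 1 : 'rV[k]_3).
  split; last by rewrite W_val !vec3E; ring.
  by rewrite vec3_eq0 oner_eq0 !andbF.
have Ec : E (vec3 0 1 0 : 'rV[k]_3).
  split; last by rewrite W_val !vec3E; ring.
  by rewrite vec3_eq0 oner_eq0 !andbF.
have coord i (y : 'rV[k]_3) : (chart k i).@[y 0] = param y 0 i by rewrite mxE.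
have : (chart k i2).@[(vec3 0 1 0 : 'rV[k]_3) 0] = 0.
  apply: (E_cofinite char0 (chart_homog k i2) (chart_homog k i0)) Ec.
    exists (vec3 0 0 1) => //; rewrite coord paramE !vec3E /tcoord !vec3E.
    by rewrite (_ : 2 * _ = 8%:R) ?char0//; ring.
  move=> x Ex ax; apply/eqP; apply: contra_notT noU => cx; exists x => //.
  by rewrite mevalM mulf_neq0.
rewrite coord paramE /tcoord !vec3E => /eqP.
by rewrite (_ : _ - _ = - 1); [rewrite oppr_eq0 oner_eq0|ring].
Qed.

Lemma param_scale (a : k) (x : 'rV[k]_3) : param (a *: x) = a ^+ 2 *: param x.
Proof.
by apply/rowP => i; rewrite !mxE (dhomog_scale _ _ (chart_homog k i)).
Qed.

Lemma paraminv_scale (a : k) (x : 'rV[k]_3) : paraminv (a *: x) = a ^+ 3 *: paraminv x.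
Proof.
by apply/rowP => i; rewrite !mxE (dhomog_scale _ _ (inv_homog k i)).
Qed.

Lemma param_same_point (x y : 'rV[k]_3) :
  same_point x y -> same_point (param x) (param y).
Proof. by case=> a a0 ->; exists (a ^+ 2); rewrite ?expf_neq0// param_scale. Qed.

Lemma paraminv_same_point (x y : 'rV[k]_3) :
  same_point x y -> same_point (paraminv x) (paraminv y).
Proof. by case=> a a0 ->; exists (a ^+ 3); rewrite ?expf_neq0// paraminv_scale. Qed.

Lemma V5_infinite : ~ finitely_many_points (@V5 k).
Proof.
move=> [l Hl]; apply: (E_infinite (k := k)).
have := E_zeros_finite char0 (base_open_homog k) base_open_nonempty.
have Ufin : finitely_many_points [set x : 'rV[k]_3 | E x /\ (base_open k).@[x 0] != 0].
  exists [seq paraminv y | y <- l] => x [Ex Ux].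
  have [Vpx ix] := param_V5 char0 Ex Ux; have [y yl ypx] := Hl _ Vpx.
  exists (paraminv y); first exact: map_f.
  exact: same_point_trans (paraminv_same_point ypx) ix.
move=> zfin; apply: finitely_many_sub (finitely_manyU zfin Ufin) => x Ex.
by have [|] := eqVneq (base_open k).@[x 0] 0; [left|right].
Qed.

Lemma V5_zeros_finite d (F : {mpoly k[3]}) : F \is d.-homog ->
  (exists2 x, V5 x & F.@[x 0] != 0) ->
  finitely_many_points [set x | V5 x /\ F.@[x 0] = 0].
Proof.
move=> Fd [y Vy Fy]; have [Eg _ pg] := V5_paraminv char0 Vy.
have Gd := dhomog_pullback Fd (chart_homog k).
have [|l Hl] := E_zeros_finite char0 Gd.
  exists (paraminv y) => //; rewrite meval_pullback -/(param _).
  by apply: contra_neq Fy; exact: dhomog_eq0_scale Fd pg.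
exists [seq param x | x <- l] => z [Vz Fz].
have [Egz _ pgz] := V5_paraminv char0 Vz.
have [|p pl pz] := Hl (paraminv z).
  split=> //; rewrite meval_pullback -/(param _).
  exact: dhomog_eq0_scale Fd (same_point_sym pgz) Fz.
exists (param p); first exact: map_f.
exact: same_point_trans (param_same_point pz) pgz.
Qed.

Lemma closure_V5_equation (x : 'rV[k]_3) : pclosure (@V5 k) x ->
  x != 0 /\ quintic (x 0 i0) (x 0 i1) (x 0 i2) = 0.
Proof.
move=> /(pclosure_homog _ (@V5_neq0 k))[x0 Hx]; split=> //.
rewrite -quintic_form_val; apply: Hx (quintic_form_homog k) _ => y.
by rewrite quintic_form_val => /V5_equation[].
Qed.

(** The points of the closure outside the period-5 curve satisfy the quintic
   equation and a c = 0. *)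
Lemma closure_V5_diff : finitely_many_points (pclosure (@V5 k) `\` @V5 k).
Proof.
(* P1(m) is the quintic at (0, 1, m) and P2(b) is the quintic at (1, b, 0). *)
pose P1 : {poly k} := (1 + 'X) ^+ 3 * ((1 + 'X) ^+ 2 + 1).
pose P2 : {poly k} := (1 + 'X) ^+ 2 * (1 + 2 *: 'X) * (1 + 3 *: 'X + 'X ^+ 2).
have P10 : P1 != 0.
  apply/eqP => /(congr1 (fun p : {poly k} => p.[0])).
  rewrite /P1 !hornerR => /eqP; rewrite (_ : _ * _ = 2%:R) ?char0//; ring.
have P20 : P2 != 0.
  apply/eqP => /(congr1 (fun p : {poly k} => p.[0])).
  rewrite /P2 !hornerR => /eqP; rewrite (_ : _ * _ = 1) ?oner_eq0//; ring.
have [l1 Hl1] := finite_roots P10; have [l2 Hl2] := finite_roots P20.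
exists ([seq vec3 0 1 m | m <- l1] ++ [seq vec3 1 b 0 | b <- l2]).
move=> x [/closure_V5_equation[xn0 q0] nVx].
have [x0|x0] := eqVneq (x 0 i0) 0; last first.
  have x2 : x 0 i2 = 0.
    by apply/eqP; apply: contra_notT nVx => x2; apply/V5_equation.
  exists (vec3 1 (x 0 i1 / x 0 i0) 0).
    rewrite mem_cat [X in _ || X]map_f ?orbT//; apply: Hl2; rewrite /P2 !hornerR.
    apply: (mulfI (expf_neq0 5 x0)); rewrite mulr0 -q0 x2 /quintic.
    by field; exact: x0.
  exists (x 0 i0) => //; rewrite scale_vec3 -[LHS]vec3_eta x2 mulr0 mulr1.
  by rewrite mulrC divfK.
move: q0; rewrite x0 => q0.
have x1 : x 0 i1 != 0.
  apply: contra_neq xn0 => x1; apply: row3P; rewrite mxE//.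
  move/eqP: q0; rewrite x1 /quintic (_ : _ + _ = x 0 i2 ^+ 5); last by ring.
  by rewrite expf_eq0 => /eqP.
exists (vec3 0 1 (x 0 i2 / x 0 i1)).
  rewrite mem_cat map_f//; apply: Hl1; rewrite /P1 !hornerR.
  apply: (mulfI (expf_neq0 5 x1)); rewrite mulr0 -q0 /quintic.
  by field; exact: x1.
exists (x 0 i1) => //; rewrite scale_vec3 -[LHS]vec3_eta x0 mulr0 mulr1.
by rewrite mulrC divfK.
Qed.

Lemma closure_V5_curve : irreducible_projective_curve (pclosure (@V5 k)).
Proof.
apply: curve_criterion; [exact: V5_neq0|exact: V5_infinite|exact: closure_V5_diff|].
exact: V5_zeros_finite.
Qed.

(** The common zeros of the first chart on the cubic are T = s = r, where the
   first coordinate of the second chart is - 2 r^3. *)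
Lemma param'_neq0 x : E x -> param x = 0 -> param' x != 0 :> 'rV[k]_3.
Proof.
case=> x0; rewrite W_weierstrass paramE param'E; set T := tcoord x.
set s := x 0 i1; set r := x 0 i2 => Wx /eqP.
rewrite !vec3_eq0 => /and3P[/eqP A0 /eqP B0]; rewrite B0 subr0 oppr_eq0 => C0.
have TE : T = x 0 i0 + 2 * r by [].
have Ts : T = s.
  move: C0; rewrite mulf_eq0 char0/= mulf_eq0 subr_eq0 => /orP[/eqP//|/eqP r0].
  have /eqP : T ^+ 3 = 0.
    apply: (mulfI (_ : 4 != 0 :> k)); first by rewrite char0.
    by rewrite mulr0 -[RHS]oppr0 -Wx /weierstrass r0; ring.
  rewrite expf_eq0/= => /eqP T0; move/eqP: B0.
  by rewrite T0 mul0r mulr0 subr0 addr0 expf_eq0/= => /eqP ->.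
have /eqP : T * (T - r) = 0.
  apply: (mulfI (_ : 4 != 0 :> k)); first by rewrite char0.
  by rewrite mulr0 -B0 -Ts; ring.
rewrite mulf_eq0 subr_eq0 => /orP[/eqP T0|/eqP Tr].
  have /eqP : 4 * r ^+ 3 = 0 by rewrite -Wx /weierstrass -Ts T0; ring.
  rewrite mulf_eq0 char0 expf_eq0/= => /eqP r0.
  have xz : x 0 i0 = 0 by move: TE; rewrite T0 r0 mulr0 addr0.
  by move: x0; rewrite -[x]vec3_eta -/s -/r -Ts xz T0 r0 vec3_eq0 eqxx.
have r0 : r != 0.
  apply: contra_neq x0 => r0; rewrite -[x]vec3_eta -/s -/r -Ts.
  have -> : x 0 i0 = 0 by move: TE; rewrite Tr r0 mulr0 addr0.
  by rewrite Tr r0; apply: row3P; rewrite !vec3E mxE.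
rewrite Tr (_ : 2 * _ = - 2 * r ^+ 3); last by ring.
by rewrite mulf_eq0 oppr_eq0 char0/= expf_eq0/= (negPf r0).
Qed.

Lemma paramf_neq0 (x : 'rV[k]_3) : E x -> paramf x != 0.
Proof.
move=> Ex; rewrite /paramf; case: ifP => [/eqP p0|/negbT//]; exact: param'_neq0 Ex p0.
Qed.

(** Both charts satisfy the equations of the closure of V5, since they do so on
   the open set where the first one takes its values in V5. *)
Lemma paramf_in x : E x -> pclosure (@V5 k) (paramf x).
Proof.
move=> Ex; apply/(pclosure_homog _ (@V5_neq0 k)); split; first exact: paramf_neq0.
move=> d F Fd FV.
have Fp y : E y -> F.@[param y 0] = 0.
  move=> Ey; have := dhomog_pullback Fd (chart_homog k) => Gd.
  rewrite -meval_pullback.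
  apply: (E_cofinite char0 Gd (base_open_homog k) base_open_nonempty) Ey => z Ez Uz.
  by rewrite meval_pullback; apply: FV; have [] := param_V5 char0 Ez Uz.
have [U EU bU] := base_open_nonempty.
rewrite /paramf; case: ifP => _; last exact: Fp.
have Gd := dhomog_pullback Fd (chart'_homog k).
rewrite -meval_pullback.
apply: (E_cofinite char0 Gd (chart_homog k i0)) Ex.
  by exists U => //; move: bU; rewrite mevalM mulf_eq0 negb_or => /andP[].
move=> y Ey ay; rewrite meval_pullback -/(param' y).
have ay' : param y 0 i0 != 0 by rewrite mxE.
have -> : param' y = (param' y 0 i0 / param y 0 i0) *: param y.
  apply/rowP => j; rewrite [RHS]mxE; apply: (mulIf ay').
  by rewrite mulrAC divfK// (param_minors j i0 Ey).
by rewrite (dhomog_scale _ _ Fd) Fp// mulr0.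
Qed.

Lemma paramf_regular : regular_map E (@paramf k).
Proof.
move=> x Ex; rewrite -/(E x); have [p0|p0] := eqVneq (param x) 0; last first.
  exists 2%N, (chart k); split=> // [j|y Ey py]; first exact: chart_homog.
  by rewrite /paramf ifN//; exact: same_point_refl.
exists 3%N, (chart' k); split=> [j||y Ey py]; first exact: chart'_homog.
  exact: param'_neq0 Ex p0.
apply: same_point_minors; [exact: paramf_neq0|exact: py|].
move=> i j; rewrite -/(param' y) /paramf; case: ifP => _; first by rewrite mulrC.
by rewrite mulrC (param_minors j i Ey) mulrC.
Qed.

Lemma paramf_birational : birational_morphism E (pclosure (@V5 k)) (@paramf k).
Proof.
have Uparam x : E x -> (base_open k).@[x 0] != 0 -> paramf x = param x.
  move=> Ex Ux; rewrite /paramf ifN//.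
  by have [/V5_neq0] := param_V5 char0 Ex Ux.
split; [exact: paramf_regular|exact: paramf_in|].
exists [set x | E x /\ (base_open k).@[x 0] != 0], (@V5 k), (@paraminv k); split.
- split; last by have [x Ex Ux] := base_open_nonempty; exists x.
  exists [set x : 'rV[k]_3 | x != 0 /\ (base_open k).@[x 0] = 0].
    exists [set base_open k]; split.
      by move=> _ ->; exists 4%N; exact: base_open_homog.
    by move=> x; split=> -[x0 Hx]; split=> //; [move=> _ ->|exact: Hx].
  move=> x; split=> -[Ex Ux]; split=> //; first by case=> _ /eqP; apply/negP.
  by apply/eqP => Ux0; apply: Ux; split=> //; case: Ex.
- split; last first.
    have [x Ex Ux] := base_open_nonempty; exists (param x).
    by have [] := param_V5 char0 Ex Ux.
  exists [set x : 'rV[k]_3 | x != 0 /\ ('X_i0 * 'X_i2 : {mpoly k[3]}).@[x 0] = 0].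
    exists [set 'X_i0 * 'X_i2]; split.
      by move=> _ ->; exists 2%N; dhom.
    by move=> x; split=> -[x0 Hx]; split=> //; [move=> _ ->|exact: Hx].
  move=> x; split=> [Vx|[Yx nZx]].
    split; first exact: sub_pclosure.
    have [x0 x2 _] := (V5_equation x).1 Vx.
    by case=> _ /eqP; rewrite !mevalR mulf_eq0 (negPf x0) (negPf x2).
  have [xn0 q0] := closure_V5_equation Yx; apply/V5_equation.
  have : x 0 i0 * x 0 i2 != 0.
    by apply/eqP => xx; apply: nZx; split=> //; rewrite !mevalR.
  by rewrite mulf_eq0 negb_or => /andP[].
- move=> x Vx; exists 3%N, (inv k); split=> [j||y Vy _].
  + exact: inv_homog.
  + by have [[]] := V5_paraminv char0 Vx.
  exact: same_point_refl.
- move=> x [Ex Ux]; rewrite Uparam//; exact: param_V5.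
move=> y Vy; have [Eg Ug pg] := V5_paraminv char0 Vy.
by rewrite Uparam.
Qed.

End Birational.

Theorem mainTheorem1 (R : realType) :
  geometric_genus_eq (pclosure (plane_embedding (V_set R[i]%C 5))) 1.
Proof.
have char0 n : (n%:R == 0 :> R[i]%C)%R = (n == 0)%N by rewrite Num.Theory.pnatr_eq0.
split; first exact: (closure_V5_curve char0).
exists 2, E, (@paramf _); split.
- exact: (E_smooth char0).
- exact: (paramf_birational char0).
exact: (E_genus char0).
Qed.
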